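(* Let $f$ be a continuous self-map of a topological tree $T$ and let $\tilde f$ be the induced map on the hyperspace of subcontinua of $T$. Then $$\mathrm{C}(\tilde f)=\{\{x\}: x\in \mathrm{C}(f)\}\cup \operatorname{Per}(\tilde f)\cup\mathcal S,$$ where $\mathrm{C}(\cdot)$ denotes the Birkhoff center, $\operatorname{Per}(\tilde f)$ is the set of periodic points of $\tilde f$, and $\mathcal S$ is the set of all nondegenerate connected components of intersections $\bigcap_{n\ge1} K_n$, taken over all generating sequences $(K_n)_{n\ge 1}$ of cycles of trees for $f$.
   Context: A topological graph is a continuum (compact connected metric space) homeomorphic to the geometric carrier of a (finite) one-dimensional simplicial complex; a topological tree is a topological graph containing no subset homeomorphic to the circle. The hyperspace of all nonempty subcontinua of $T$ (including singletons) carries the Hausdorff metric, and $\tilde f(A)=f(A)$. For a dynamical system $(X,g)$, a point $x$ is recurrent if $x\in\omega_g(x)$, $\operatorname{Rec}(g)$ is the set of recurrent points, and the Birkhoff center is $\mathrm{C}(g)=\overline{\operatorname{Rec}(g)}$. Nondegenerate means not a singleton. A cycle of trees of period $k\ge1$ is a set $K=\bigcup_{i=0}^{k-1}f^i(L)$, where $L\subset T$ is a nondegenerate subcontinuum such that $L,f(L),\dots,f^{k-1}(L)$ are pairwise disjoint and $f^k(L)=L$. A generating sequence (a sequence generating a solenoidal set) is a nested sequence $K_1\supset K_2\supset\cdots$ of cycles of trees for $f$ whose periods tend to infinity. *)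

(* Defs.v *)
From HB Require Import structures.
From mathcomp Require Import all_boot all_order all_algebra finmap.
From mathcomp Require Import all_classical all_reals all_analysis.

Set Implicit Arguments.
Unset Strict Implicit.
Unset Printing Implicit Defensive.

Import Order.TTheory GRing.Theory Num.Theory.
Import numFieldNormedType.Exports.

Local Open Scope classical_set_scope.
Local Open Scope ring_scope.

Definition homeomorphic (X Y : topologicalType) (A : set X) (B : set Y) : Prop :=
  exists (h : X -> Y) (g : Y -> X),
    [/\ set_bij A B h, {in A, cancel h g},
        {within A, continuous h} & {within B, continuous g}].

Section SimplicialComplex.
Context {R : realType} {n : nat}.

Definition affinely_independent (s : {fset 'rV[R]_n}) : Prop :=
  forall a : 'rV[R]_n -> R,
    \sum_(v <- s) a v = 0 -> \sum_(v <- s) a v *: v = 0 ->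
    forall v, v \in s -> a v = 0.

(* The simplex with vertex set [s]; it is empty when [s] is. *)
Definition simplex (s : {fset 'rV[R]_n}) : set 'rV[R]_n :=
  [set x | exists a : 'rV[R]_n -> R,
     [/\ forall v, v \in s -> 0 <= a v,
         \sum_(v <- s) a v = 1 & x = \sum_(v <- s) a v *: v]].

(* A finite geometric simplicial complex, each simplex being given by its set
   of vertices. In the last condition, two simplices without common vertex are
   disjoint, since [simplex fset0] is empty. *)
Definition simplicial_complex (K : {fset {fset 'rV[R]_n}}) : Prop :=
  [/\ forall s, s \in K -> s != fset0 /\ affinely_independent s,
      forall s t, s \in K -> (t `<=` s)%fset -> t != fset0 -> t \in K
    & forall s t, s \in K -> t \in K ->
        simplex s `&` simplex t = simplex (s `&` t)%fset].

Definition complex_dim (K : {fset {fset 'rV[R]_n}}) : nat :=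
  (\max_(s <- K) #|` s|.-1)%N.

Definition carrier (K : {fset {fset 'rV[R]_n}}) : set 'rV[R]_n :=
  [set x | exists2 s, s \in K & simplex s x].

End SimplicialComplex.

Definition circle (R : realType) : set (R * R) :=
  [set p | p.1 ^+ 2 + p.2 ^+ 2 = 1].
Arguments circle R : clear implicits.

Section Trees.
Context {R : realType}.

Definition topological_graph (T : metricType R) : Prop :=
  [/\ compact [set: T], connected [set: T] &
      exists (n : nat) (K : {fset {fset 'rV[R]_n}}),
        [/\ simplicial_complex K, complex_dim K = 1%N &
            homeomorphic [set: T] (carrier K)]].

Definition topological_tree (T : metricType R) : Prop :=
  topological_graph T /\ ~ exists C : set T, homeomorphic C (circle R).

End Trees.

Section Subcontinua.
Context {T : topologicalType}.

Definition subcontinuum (A : set T) : Prop :=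
  [/\ A !=set0, compact A & connected A].

Definition nondegenerate (A : set T) : Prop := forall x, A <> [set x].

Lemma subcontinuum1 (x : T) : subcontinuum [set x].
Proof. by split; [exists x | exact: compact_set1 | exact: connected1]. Qed.

Lemma subcontinuum_image (f : T -> T) (A : set T) :
  continuous f -> subcontinuum A -> subcontinuum (f @` A).
Proof.
move=> cf [[x Ax] cA kA]; have cfA := continuous_subspaceT (A := A) cf.
split; first by exists (f x), x.
- exact: continuous_compact.
- exact: connected_continuous_connected.
Qed.

End Subcontinua.

Section HausdorffMetric.
Context {R : realType} {T : metricType R}.
Implicit Types (A B C : set T) (x y : T).

Definition point_dist x A : R := inf [set mdist x a | a in A].

Definition excess A B : R := sup [set point_dist a B | a in A].

Definition hausdorff_dist A B : R := Num.max (excess A B) (excess B A).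

Let has_inf_mdist x A : A !=set0 -> has_inf [set mdist x a | a in A].
Proof.
move=> [a Aa]; split; first by exists (mdist x a), a.
by exists 0 => _ [b _ <-]; exact: mdist_ge0.
Qed.

Let point_dist_le x A a : A a -> point_dist x A <= mdist x a.
Proof.
move=> Aa; apply: ge_inf; last by exists a.
by exists 0 => _ [b _ <-]; exact: mdist_ge0.
Qed.

Let point_dist_ge0 x A : A !=set0 -> 0 <= point_dist x A.
Proof.
move=> [a Aa]; apply: lb_le_inf; first by exists (mdist x a), a.
by move=> _ [b _ <-]; exact: mdist_ge0.
Qed.

Let compact_mdist_bounded A x : compact A ->
  exists M : R, forall a, A a -> mdist x a <= M.
Proof.
move=> cA.
have dc : continuous (mdist x : T -> R^o).
  move=> a; apply/cvgrPdist_lt => e e0.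
  have : nbhs a (ball a e) by exact: nbhsx_ballx.
  apply: filterS => b; rewrite ballEmdist /= => ab.
  rewrite ltr_norml; apply/andP; split.
    rewrite ltrBrDr addrC ltrBlDr.
    by rewrite (le_lt_trans (metric_triangle x a b))// ltrD2l.
  rewrite ltrBlDr (le_lt_trans (metric_triangle x b a))//.
  by rewrite addrC ltrD2r metric_sym.
have /compact_bounded[M [_ MA]] : compact ((mdist x : T -> R^o) @` A).
  by apply: continuous_compact => //; exact: continuous_subspaceT.
exists (M + 1) => a Aa; apply: le_trans (ler_norm _) _.
by apply: (MA (M + 1)); [rewrite ltrDl | exists a].
Qed.

Let has_sup_excess A B : subcontinuum A -> subcontinuum B ->
  has_sup [set point_dist a B | a in A].
Proof.
move=> [[a Aa] cA _] [[b Bb] cB _]; split; first by exists (point_dist a B), a.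
have [M MA] := compact_mdist_bounded b cA.
exists M => _ [c Ac <-]; apply: le_trans (point_dist_le c Bb) _.
by rewrite metric_sym; exact: MA.
Qed.

Let point_dist_excess A B a : subcontinuum A -> subcontinuum B -> A a ->
  point_dist a B <= excess A B.
Proof.
move=> sA sB Aa; apply: ub_le_sup; last by exists a.
exact: (has_sup_excess sA sB).2.
Qed.

Let excess_xx A : subcontinuum A -> excess A A = 0.
Proof.
move=> sA; have [A0 _ _] := sA; have [a Aa] := A0.
have pd0 b : A b -> point_dist b A = 0.
  move=> Ab; apply/eqP; rewrite eq_le point_dist_ge0// andbT.
  by rewrite -(mdistxx b); exact: point_dist_le.
rewrite /excess (_ : [set _ | _ in _] = [set 0]) ?sup1//.
apply/seteqP; split=> [_ [b Ab <-]|_ ->] /=; first exact: pd0.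
by exists a => //; exact: pd0.
Qed.

Let excess_le0_sub A B : subcontinuum A -> subcontinuum B ->
  excess A B <= 0 -> A `<=` B.
Proof.
move=> sA sB AB a Aa; have [B0 cB _] := sB.
have clB : closed B by exact: (compact_closed (@metric_hausdorff _ T) cB).
apply: clB => U /nbhs_ballP[e /= e0 aU].
have [_ [b Bb <-] abe] := inf_adherent e0 (has_inf_mdist a B0).
exists b; split => //; apply: aU; rewrite ballEmdist /=.
apply: lt_le_trans abe _; rewrite gerDr.
exact: le_trans (point_dist_excess sA sB Aa) AB.
Qed.

Let excess_triangle A B C :
  subcontinuum A -> subcontinuum B -> subcontinuum C ->
  excess A C <= excess A B + excess B C.
Proof.
move=> sA sB sC; have [[a0 Aa0] _ _] := sA; have [B0 _ _] := sB.
have [C0 _ _] := sC.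
apply: ge_sup; first by exists (point_dist a0 C), a0.
move=> _ [a Aa <-]; apply/ler_addgt0Pr => e e0.
have e20 : 0 < e / 2 by rewrite divr_gt0.
have [_ [b Bb <-] abe] := inf_adherent e20 (has_inf_mdist a B0).
have [_ [c Cc <-] bce] := inf_adherent e20 (has_inf_mdist b C0).
apply: le_trans (point_dist_le a Cc) _; apply: le_trans (metric_triangle a b c) _.
rewrite [e]splitr addrACA; apply: lerD.
  by apply: le_trans (ltW abe) _; rewrite lerD2r point_dist_excess.
by apply: le_trans (ltW bce) _; rewrite lerD2r point_dist_excess.
Qed.

Lemma hausdorff_distxx A : subcontinuum A -> hausdorff_dist A A = 0.
Proof. by move=> sA; rewrite /hausdorff_dist maxxx excess_xx. Qed.

Lemma hausdorff_distC A B : hausdorff_dist A B = hausdorff_dist B A.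
Proof. exact: maxC. Qed.

Lemma hausdorff_dist_eq0 A B : subcontinuum A -> subcontinuum B ->
  hausdorff_dist A B = 0 -> A = B.
Proof.
move=> sA sB AB0; have : hausdorff_dist A B <= 0 by rewrite AB0.
rewrite ge_max => /andP[AB BA].
by apply/seteqP; split; exact: excess_le0_sub.
Qed.

Lemma hausdorff_dist_triangle B A C :
  subcontinuum A -> subcontinuum B -> subcontinuum C ->
  hausdorff_dist A C <= hausdorff_dist A B + hausdorff_dist B C.
Proof.
move=> sA sB sC; rewrite {1}/hausdorff_dist ge_max; apply/andP; split.
  apply: le_trans (excess_triangle sA sB sC) _.
  by apply: lerD; rewrite /hausdorff_dist le_max lexx.
apply: le_trans (excess_triangle sC sB sA) _; rewrite addrC.
by apply: lerD; rewrite /hausdorff_dist le_max lexx orbT.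
Qed.

End HausdorffMetric.

Definition hyperspace {R : realType} (T : metricType R) : Type :=
  {A : set T | subcontinuum A}.

Section Hyperspace.
Context {R : realType} {T : metricType R}.
Implicit Types A B C : hyperspace T.

HB.instance Definition _ := gen_eqMixin (hyperspace T).
HB.instance Definition _ := gen_choiceMixin (hyperspace T).

Let dist A B : R := hausdorff_dist (sval A) (sval B).

Let distxx A : dist A A = 0.
Proof. exact: hausdorff_distxx (svalP A). Qed.

Let dist_positivity A B : dist A B = 0 -> A = B.
Proof.
case: A B => [A sA] [B sB] /(hausdorff_dist_eq0 sA sB) AB.
exact: eq_exist.
Qed.

Let dist_sym A B : dist A B = dist B A.
Proof. exact: hausdorff_distC. Qed.

Let dist_triangle B A C : dist A C <= dist A B + dist B C.
Proof. exact: hausdorff_dist_triangle (svalP A) (svalP B) (svalP C). Qed.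

HB.instance Definition _ := isMetric.Build R (hyperspace T)
  distxx dist_positivity dist_sym dist_triangle.

Lemma hyperspace_mdistE A B : mdist A B = hausdorff_dist (sval A) (sval B).
Proof. by []. Qed.

Definition singleton (x : T) : hyperspace T := exist _ _ (subcontinuum1 x).

Definition induced_map (f : T -> T) (cf : continuous f) (A : hyperspace T) :
    hyperspace T :=
  exist _ _ (subcontinuum_image cf (svalP A)).

End Hyperspace.

Section Dynamics.
Context {X : topologicalType}.
Implicit Types (g : X -> X) (x : X).

Definition omega_limit g x : set X := cluster (iter n g x @[n --> \oo]).

Definition Rec g : set X := [set x | omega_limit g x x].

Definition birkhoff_center g : set X := closure (Rec g).

Definition Per g : set X := [set x | exists2 n, (0 < n)%N & iter n g x = x].

End Dynamics.

Section Solenoidal.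
Context {R : realType} {T : metricType R}.
Implicit Types (f : T -> T) (k : nat) (K L A : set T).

Definition cycle_of_trees f k K : Prop :=
  (1 <= k)%N /\ exists L,
    [/\ subcontinuum L /\ nondegenerate L,
        trivIset `I_k (fun i => iter i f @` L),
        iter k f @` L = L
      & K = \bigcup_(i in `I_k) (iter i f @` L)].

Definition generating_sequence f (K : nat -> set T) : Prop :=
  exists k : nat -> nat,
    [/\ forall n, cycle_of_trees f (k n) (K n),
        forall n, K n.+1 `<=` K n
      & k n @[n --> \oo] --> \oo].

Definition is_component (Q A : set T) : Prop :=
  exists2 x, Q x & A = connected_component Q x.

Definition solenoidal_components f : set (hyperspace T) :=
  [set A | nondegenerate (sval A) /\
     exists2 K, generating_sequence f K &
       is_component (\bigcap_n K n) (sval A)].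

End Solenoidal.

(* Main.v *)
(* A topological tree carries a compatible R-tree metric with finitely many
   ends. A nondegenerate recurrent continuum A meets some iterate f^n(A), hence
   contains a fixed point p of f^n: otherwise the iterates of A would drift
   steadily towards a fixed point outside their union. A continuum through p is
   the union of its arms in the directions of the ends; by Ramsey's theorem,
   applied to the choice of the arm which covers a given arm of the next iterate,
   f^(nM)(A) = A, where M depends only on the number of ends.
   Hence a nondegenerate A in the Birkhoff center is a limit of periodic continua
   A_n. If, for some i, there are A_n arbitrarily close to A meeting f^i(A_n),
   then f^(iM)(A) = A. Otherwise the first return times m_n tend to infinity, and
   the union L_n of the orbit of A_n under f^(m_n) generates a cycle of trees of
   period m_n. Since more disjoint continua than there are ends, all meeting A_j,
   cannot all leave A_j, we have L_n contained in A_j when n is large with respect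
   to j; so, along a subsequence, the L_n decrease to A. *)

From mathcomp Require Import all_boot all_order all_algebra finmap.
From mathcomp Require Import all_classical all_reals all_analysis.
From mathcomp Require Import lra zify.
Require Import Defs.

Set Implicit Arguments.
Unset Strict Implicit.
Unset Printing Implicit Defensive.

Import Order.TTheory GRing.Theory Num.Theory.
Import numFieldNormedType.Exports.

Local Open Scope classical_set_scope.
Local Open Scope ring_scope.

(** * Tree metrics *)

(** The given distance of [T] says nothing about branching. A second metric [D] is therefore built,
    edge by edge along the complex; with it, betweenness and directions become linear relations
    between distances, and the stability of directions under small perturbations becomes a strict
    inequality. The topology of [T] returns only through continuity of [D] and compactness.
    Recurrence in the hyperspace gives approximate returns only. They are made exact by closed
    conditions: a closed set which meets, or contains, all late iterates of [A] meets, or contains,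
    [A]. A limit of periodic continua need not be periodic when the periods are unbounded. This is
    why [M] must not depend on the continuum, and why the colours in Ramsey's theorem are maps
    between finitely many ends: an equality with a fixed exponent passes to the limit. When no fixed
    exponent is available, what remains is exactly the solenoidal case. *)

(* Since [D x x = 0], the four-point condition contains the triangle
   inequality; with the geodesics it says that [S] is an R-tree. *)
Record tree_metric {R : realType} {X : topologicalType} (S : set X)
    (D : X -> X -> R) (E : seq X) : Prop := TreeMetric {
  tm_refl : forall x, D x x = 0;
  tm_sym : forall x y, D x y = D y x;
  tm_sep : forall x y, S x -> S y -> D x y = 0 -> x = y;
  tm_four : forall x y z w, S x -> S y -> S z -> S w ->
    D x y + D z w <= D x z + D y w \/ D x y + D z w <= D x w + D y z;
  tm_geo : forall x y t, S x -> S y -> 0 <= t <= D x y ->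
    exists2 z, S z & D x z = t /\ D z y = D x y - t;
  tm_cont : forall x e, S x -> 0 < e -> \forall y \near x, S y -> D x y < e;
  tm_endsS : forall e, e \in E -> S e;
  tm_ends : forall b x, S b -> S x ->
    exists2 e, e \in E & D b x + D x e = D b e }.

Section TreeMetric.
Context {R : realType} {X : topologicalType} (S : set X) (D : X -> X -> R)
  (E : seq X) (hD : tree_metric S D E).

Lemma tm_ge0 x y : S x -> S y -> 0 <= D x y.
Proof.
move=> Sx Sy; have := tm_four hD Sx Sx Sy Sy.
by rewrite !(tm_refl hD); case; lra.
Qed.

Lemma tm_tri x y z : S x -> S y -> S z -> D x z <= D x y + D y z.
Proof.
move=> Sx Sy Sz; have := tm_four hD Sx Sz Sy Sy.
by rewrite !(tm_refl hD) (tm_sym hD z y); case; lra.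
Qed.

Lemma tm_within_continuous x : S x -> {within S, continuous (D x : X -> R^o)}.
Proof.
move=> Sx; apply/subspace_continuousP => y Sy; apply/cvgrPdist_lt => e e0.
have := tm_cont hD Sy e0; apply: filterS => z yz Sz; have {}yz := yz Sz.
have := tm_tri Sx Sy Sz; have := tm_tri Sx Sz Sy; rewrite (tm_sym hD z y).
by move=> h1 h2; rewrite ltr_norml /from_subspace; apply/andP; split; lra.
Qed.

(** The record only asks that topological neighbourhoods be small for [D]. The converse comes from
    compactness: outside an open set containing [x], the function [D x] attains a minimum, positive
    by separation. *)
Lemma tm_nbhs x (U : set X) : compact S -> S x -> nbhs x U ->
  exists2 e : R, 0 < e & forall y, S y -> D x y < e -> U y.
Proof.
move=> cS Sx; rewrite nbhsE => -[V [oV Vx] VU].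
have [SV|/existsNP[y /not_implyP[Sy Vy]]] := pselect (forall y, S y -> V y).
  by exists 1 => // y Sy _; exact/VU/SV.
have SV0 : S `&` ~` V !=set0 by exists y.
have cV : compact (S `&` ~` V) by apply: compact_closedI => //; rewrite closedC.
have [m + mmin] := compact_EVT_min SV0 cV
  (continuous_subspaceW (@subIsetl _ S (~` V)) (tm_within_continuous Sx)).
rewrite inE => -[Sm Vm]; exists (D x m).
  rewrite lt_neqAle tm_ge0// andbT; apply/eqP => /esym/(tm_sep hD Sx Sm) xm.
  by apply: Vm; rewrite -xm.
move=> z Sz xz; apply: VU; apply: contrapT => Vz.
by have := mmin z; rewrite inE => /(_ (conj Sz Vz)); rewrite leNgt xz.
Qed.

(** [tm_geo] provides the points one parameter at a time, with no link between them. The four-point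
    condition for [x], [y], [g s], [g t] forces these independent choices to form an isometric
    path. *)
Lemma tm_geodesic x y : S x -> S y -> exists g : R -> X,
  [/\ g 0 = x, g (D x y) = y,
      forall t, 0 <= t <= D x y -> S (g t) /\ D x (g t) + D (g t) y = D x y &
      forall s t, 0 <= s <= D x y -> 0 <= t <= D x y -> D (g s) (g t) = `|s - t|].
Proof.
move=> Sx Sy; pose P t z := 0 <= t <= D x y ->
  [/\ S z, D x z = t & D z y = D x y - t].
have /choice[g gP] : forall t, exists z, P t z.
  move=> t; have [/(tm_geo hD Sx Sy)[z Sz [xz zy]]|tn] := pselect (0 <= t <= D x y).
    by exists z.
  by exists x => /tn.
have L0 := tm_ge0 Sx Sy.
have h0 : 0 <= (0 : R) <= D x y by lra.
have hL : 0 <= D x y <= D x y by lra.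
exists g; split.
- by have [Sg /(tm_sep hD Sx Sg)] := gP _ h0.
- by have [Sg _ +] := gP _ hL; rewrite subrr => /(tm_sep hD Sg Sy).
- by move=> t /gP[Sg xg gy]; split => //; lra.
move=> s t; wlog st : s t / s <= t => [H hs ht|hs ht].
  have /orP[/H->//|ts] := le_total s t.
  by rewrite (tm_sym hD) distrC H.
have [Ss xs sy] := gP _ hs; have [St xt ty] := gP _ ht.
have := tm_tri Sx Ss St; have := tm_four hD Sx Sy Ss St.
rewrite (tm_sym hD y) (tm_sym hD y (g s)) distrC ger0_norm; last by lra.
by move=> h1 h2; apply/eqP; rewrite eq_le; apply/andP; split; case: h1; lra.
Qed.

Lemma tm_geodesic_continuous (g : R -> X) (a : R) : compact S ->
  (forall t, 0 <= t <= a -> S (g t)) ->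
  (forall s t, 0 <= s <= a -> 0 <= t <= a -> D (g s) (g t) = `|s - t|) ->
  {within `[0, a], continuous g}.
Proof.
move=> cS Sg gD; apply/subspace_continuousP => s; rewrite /= in_itv /= => hs U.
move=> /(tm_nbhs cS (Sg _ hs))[e e0 eU].
change (nbhs s (fun t => `[0, a]%classic t -> U (g t))).
have := nbhsx_ballx s e e0; apply: filterS => t st; rewrite /= in_itv /= => ht.
by apply: eU; [exact: Sg|rewrite gD].
Qed.

End TreeMetric.

Section Tree.
Context {R : realType} {T : metricType R} (D : T -> T -> R) (E : seq T)
  (hD : tree_metric [set: T] D E) (cT : compact [set: T]).
Implicit Types (x y z b c u v w : T) (A B C L : set T).

Definition seg x y : set T := [set z | D x z + D z y = D x y].

Let Dxx x : D x x = 0. Proof. exact: tm_refl hD x. Qed.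
Let Dge0 x y : 0 <= D x y. Proof. exact: (tm_ge0 hD). Qed.
Let Dtri y x z : D x z <= D x y + D y z. Proof. exact: (tm_tri hD). Qed.
Let DC x y : D x y = D y x. Proof. exact: (tm_sym hD). Qed.
Let D0 x y : D x y <= 0 -> x = y.
Proof.
by move=> xy; apply: (tm_sep hD) => //; apply/eqP; rewrite eq_le xy Dge0.
Qed.
Let Dgt0 x y : x <> y -> 0 < D x y.
Proof. by move=> xy; rewrite ltNge; apply/negP => /D0. Qed.

Lemma seg_left x y : seg x y x.
Proof. by rewrite /seg /= Dxx add0r. Qed.

Lemma seg_right x y : seg x y y.
Proof. by rewrite /seg /= Dxx addr0. Qed.

Lemma segC x y : seg x y = seg y x.
Proof. by apply/seteqP; split=> z; rewrite /seg /= (DC y z) (DC z x) (DC y x); lra. Qed.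

Lemma seg_refl x y : seg x x y -> y = x.
Proof.
by rewrite /seg /= Dxx (DC y) => h; apply/esym/D0; have := Dge0 x y; lra.
Qed.

(** Geodesic triangles are tripods. *)
Lemma seg_split x y c w : seg x y c -> seg x w c \/ seg w y c.
Proof.
rewrite /seg /= => xcy; have := @tm_four _ _ _ _ _ hD x y c w I I I I.
have := Dtri c x w; have := Dtri c w y; rewrite (DC y w) (DC w c) (DC y c).
by move=> h1 h2 []; [right|left]; lra.
Qed.

(** By [seg_split], [y] could otherwise only lie between [u] and [u'], too close to [u']. This is
    the form in which the openness of the branches at [y] is used throughout. *)
Lemma seg_stable b u u' y : seg b u y -> D u u' < D u' y -> seg b u' y.
Proof.
move=> buy uu'; have [//|] := seg_split u' buy.
rewrite /seg /= => h; move: uu'; rewrite (DC u u').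
by have := Dge0 y u; lra.
Qed.

Lemma seg_le b e y z : seg b e y -> seg b e z -> D b y <= D b z -> seg b z y.
Proof.
move=> bey bez yz; have [//|] := seg_split z bey.
rewrite /seg /= in bey bez *; move=> h.
have zy : D z y <= 0 by lra.
by rewrite (D0 zy) Dxx addr0.
Qed.

Lemma seg_trans b u y a : seg b u y -> seg b y a -> seg b u a /\ seg a u y.
Proof.
rewrite /seg /= => h1 h2; have := Dtri a b u; have := Dtri y a u.
by split; lra.
Qed.

Lemma seg_geo x y t : 0 <= t <= D x y -> exists2 z, seg x y z & D x z = t.
Proof.
move=> /(tm_geo hD (x := x) (y := y) (t := t) I I)[z _ [xz zy]].
by exists z => //; rewrite /seg /= xz zy; lra.
Qed.

Lemma near_D x e : 0 < e -> \forall y \near x, D x y < e.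
Proof.
move=> e0; have := tm_cont hD (x := x) I e0.
by apply: filterS => y; exact.
Qed.

Lemma D_continuous x : continuous (D x : T -> R^o).
Proof. exact/continuous_subspace_setT/(tm_within_continuous hD I). Qed.

Lemma closed_compact A : closed A -> compact A.
Proof. by move=> cA; exact: (subclosed_compact cA cT). Qed.

Lemma D_nbhs x (U : set T) : nbhs x U ->
  exists2 e : R, 0 < e & forall y, D x y < e -> U y.
Proof.
by move=> /(tm_nbhs hD cT I)[e e0 eU]; exists e => // y; exact: eU.
Qed.

Lemma closed_seg x y : closed (seg x y).
Proof.
have -> : seg x y = (fun z => (D x z + D y z : R^o)) @^-1` [set D x y].
  by apply/seteqP; split=> z; rewrite /seg /= (DC z y).
apply: preimage_closed => [z _|]; last exact: closed_eq.
by apply: cvgD; exact: D_continuous.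
Qed.

Lemma connected_seg x y : connected (seg x y).
Proof.
have [g [g0 gL gS gD]] := tm_geodesic hD (x := x) (y := y) I I.
have g_x t : 0 <= t <= D x y -> D x (g t) = t.
  by move=> ht; rewrite -{1}g0 gD// ?sub0r ?normrN ?ger0_norm ?lexx ?Dge0//; lra.
have -> : seg x y = g @` `[0, D x y].
  apply/seteqP; split=> [z xyz|_ [t /= + <-]]; last first.
    by rewrite in_itv /= => /gS[].
  have zin : 0 <= D x z <= D x y.
    by move: xyz; rewrite /seg /= => h; have := Dge0 x z; have := Dge0 z y; lra.
  have [_ Sg] := gS _ zin; exists (D x z); first by rewrite /= in_itv.
  apply: D0; have : seg x z (g (D x z)) by apply: (seg_le Sg xyz); rewrite g_x.
  by rewrite /seg /= g_x//; lra.
apply: connected_continuous_connected; first exact: segment_connected.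
by apply: (tm_geodesic_continuous hD cT _ gD) => t /gS[].
Qed.

(** A point [z] of the segment missing from [C] would cut it: the points behind [z], seen from [y],
    form a set which is open by [seg_stable], closed by continuity of [D], and contains [x] but not
    [y]. *)
Lemma connected_seg_sub C x y : connected C -> C x -> C y -> seg x y `<=` C.
Proof.
move=> cC Cx Cy z xyz; apply: contrapT => Cz.
have xz : x <> z by move=> xz; apply: Cz; rewrite -xz.
pose V := [set u | u <> z /\ seg y u z].
suff CV : C `&` V = C.
  move: Cy; rewrite -CV => -[_ [yz /seg_refl zy]]; exact: yz.
apply: cC.
- by exists x; split => //; split => //; rewrite segC.
- exists V => //; rewrite openE => u [uz yuz].
  have uz0 : 0 < D u z / 2 by rewrite divr_gt0// Dgt0.
  have := near_D u uz0; apply: filterS => u' uu'.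
  have := Dtri u' u z => tri; split.
    by move=> u'z; move: uu'; rewrite u'z; have := Dge0 u z; lra.
  by apply: seg_stable yuz _; lra.
- exists [set u | seg y u z].
    have -> : [set u | seg y u z] =
        (fun u => (D y z + D z u - D y u : R^o)) @^-1` [set 0].
      by apply/seteqP; split=> u; rewrite /seg /=; lra.
    apply: preimage_closed => [u _|]; last exact: closed_eq.
    apply: cvgB; last exact: D_continuous.
    by apply: cvgD; [exact: cvg_cst|exact: D_continuous].
  apply/seteqP; split=> u [Cu]; first by move=> [_ ?].
  by move=> yuz; do 2?split => //; move=> uz; apply: Cz; rewrite -uz.
Qed.

End Tree.

(** * Recognizing a circle *)

Lemma inverse_continuous {X Y : topologicalType} (K : set Y) (phi : Y -> X)
    (h : X -> Y) : hausdorff_space X -> compact K -> {within K, continuous phi} ->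
  (forall y, K y -> h (phi y) = y) -> {within phi @` K, continuous h}.
Proof.
move=> hX cK cphi hphi; apply/subspace_continuousP => _ [y Ky <-] U.
rewrite /from_subspace hphi// nbhsE => -[V [oV Vy] VU].
have cKV : compact (K `&` ~` V) by apply: compact_closedI => //; rewrite closedC.
have cim : compact (phi @` (K `&` ~` V)).
  by apply: continuous_compact => //; apply: continuous_subspaceW cphi; exact: subIsetl.
have : nbhs (phi y) (~` (phi @` (K `&` ~` V))).
  apply: open_nbhs_nbhs; split; first by rewrite openC; exact: compact_closed.
  by move=> [z [Kz Vz] /(congr1 h)]; rewrite !hphi// => zy; apply: Vz; rewrite zy.
apply: filterS => t nz [z Kz zt]; subst t; rewrite /= hphi//.
by apply: VU; apply: contrapT => Vz; apply: nz; exists z.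
Qed.

Lemma within_comp {X Y Z : topologicalType} (A : set X) (B : set Y)
    (c : X -> Y) (phi : Y -> Z) : {within A, continuous c} ->
  {within B, continuous phi} -> (forall x, A x -> B (c x)) ->
  {within A, continuous (phi \o c)}.
Proof.
move=> /subspace_continuousP cc /subspace_continuousP cphi AB.
apply/subspace_continuousP => x Ax U /(cphi _ (AB _ Ax)) cU.
have : nbhs x (fun y => A y -> B (c y) -> U (phi (c y))) := cc x Ax _ cU.
by apply: filterS => y yU Ay; exact: (yU Ay (AB _ Ay)).
Qed.

Lemma within_eq {X Y : topologicalType} (A : set X) (g h : X -> Y) :
  (forall x, A x -> g x = h x) -> {within A, continuous g} -> {within A, continuous h}.
Proof.
move=> gh /subspace_continuousP cg; apply/subspace_continuousP => x Ax U.
rewrite /from_subspace -gh// => gU.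
have : nbhs x (fun y => A y -> U (g y)) := cg x Ax U gU.
by apply: filterS => y yU Ay; rewrite /= -gh//; exact: yU.
Qed.

Section Circle.
Context {R : realType} {X : topologicalType} (hX : hausdorff_space X).

Lemma circle_bound (p : R * R) : circle R p -> -1 <= p.1 <= 1 /\ -1 <= p.2 <= 1.
Proof. by rewrite /circle /=; nra. Qed.


Lemma closed_circle : closed (circle R).
Proof.
rewrite (_ : circle R = (fun p : R * R => (p.1 * p.1 + p.2 * p.2 : R^o)) @^-1` [set 1]).
  apply: preimage_closed; last exact: closed_eq.
  by move=> p _; apply: cvgD; apply: cvgM; (exact: cvg_fst || exact: cvg_snd).
by apply/seteqP; split=> p; rewrite /circle /= !expr2.
Qed.

Lemma compact_circle : compact (circle R).
Proof.
have cK : compact (`[-1, 1]%classic `*` `[-1, 1]%classic : set (R * R)).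
  by apply: compact_setX; exact: segment_compact.
rewrite (_ : circle R = (`[-1, 1]%classic `*` `[-1, 1]%classic) `&` circle R).
  by apply: compact_closedI => //; exact: closed_circle.
apply/seteqP; split=> [p pC|p []//]; split => //.
by have := circle_bound pC; rewrite /setX /= !in_itv.
Qed.

(** The two arcs are laid over the upper and the lower half circle, parametrized by the abscissa.
    The last hypothesis constrains [s] alone: at the ends [a] and [b] agree, and injectivity of [b]
    then determines [t]. *)
Lemma homeomorphic_circle (a b : R -> X) :
  {within `[0, 1], continuous a} -> {within `[0, 1], continuous b} ->
  a 0 = b 0 -> a 1 = b 1 ->
  (forall s t, 0 <= s <= 1 -> 0 <= t <= 1 -> a s = a t -> s = t) ->
  (forall s t, 0 <= s <= 1 -> 0 <= t <= 1 -> b s = b t -> s = t) ->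
  (forall s t, 0 <= s <= 1 -> 0 <= t <= 1 -> a s = b t -> s = 0 \/ s = 1) ->
  exists C : set X, homeomorphic C (circle R).
Proof.
move=> ca cb ab0 ab1 ia ib iab.
pose c (p : R * R) : R := (p.1 + 1) / 2.
pose phi p := if 0 <= p.2 then a (c p) else b (c p).
have c01 p : circle R p -> 0 <= c p <= 1.
  by move=> /circle_bound[p1 _]; rewrite /c; lra.
have cc : continuous (c : R * R -> R).
  move=> p; apply: cvgM; last exact: cvg_cst.
  by apply: cvgD; [exact: cvg_fst|exact: cvg_cst].
have c_inj p q : circle R p -> circle R q -> c p = c q -> p.2 ^+ 2 = q.2 ^+ 2 /\ p.1 = q.1.
  rewrite /circle /c /= => hp hq pq; have pq1 : p.1 = q.1 by lra.
  by split => //; rewrite pq1 in hp; lra.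
have c_end p : circle R p -> c p = 0 \/ c p = 1 -> p.2 = 0.
  rewrite /circle /c /= => hp h; apply/eqP; rewrite -sqrf_eq0; apply/eqP.
  have [h1|h1] : p.1 = -1 \/ p.1 = 1 by case: h => h; [left|right]; lra.
    by rewrite h1 in hp; nra.
  by rewrite h1 in hp; nra.
(* At the two points of ordinate 0 both formulas agree, so [phi] can be glued along the closed half
   circles. *)
have phi_neg p : circle R p -> p.2 <= 0 -> phi p = b (c p).
  move=> hp p0; rewrite /phi; case: ifPn => // p0'.
  have p20 : p.2 = 0 by lra.
  have : (c p == 0) || (c p == 1).
    move: hp; rewrite /circle /= p20 expr0n /= addr0 => /eqP; rewrite sqrf_eq1.
    by rewrite /c => /orP[/eqP->|/eqP->]; apply/orP; [right|left]; apply/eqP; lra.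
  by move=> /orP[/eqP->|/eqP->].
have phi_inj p q : circle R p -> circle R q -> phi p = phi q -> p = q.
  wlog pq : p q / q.2 <= p.2.
    move=> H hp hq; have /orP[h|h] := le_total q.2 p.2; first exact: H.
    by move=> /esym/(H _ _ h hq hp).
  move=> hp hq; suff : phi p = phi q -> p.2 = q.2 /\ p.1 = q.1.
    by case: p q {pq hp hq} => p1 p2 [q1 q2] /= h /h[-> ->].
  have [p0|p0] := lerP 0 p.2; last first.
    rewrite !phi_neg//; [|lra|lra] => /ib/(c_inj _ _ hp hq)[]; [exact: c01|exact: c01|].
    by move=> h1 h2; split => //; nra.
  have [q0|q0] := lerP 0 q.2.
    rewrite /phi p0 q0 => /ia/(c_inj _ _ hp hq)[]; [exact: c01|exact: c01|].
    by move=> h1 h2; split => //; nra.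
  rewrite (phi_neg q) ?(ltW q0)// {1}/phi p0 => pq'.
  have /(c_end _ hp) p20 := iab _ _ (c01 _ hp) (c01 _ hq) pq'.
  have pb : phi p = b (c p) by apply: phi_neg => //; lra.
  move: pb; rewrite /phi p0 pq' => /esym/ib/(c_inj _ _ hp hq)[]; [exact: c01|exact: c01|].
  by move=> h1 h2; split => //; nra.
have cphi : {within circle R, continuous phi}.
  have closed2 (A : set R) : closed A -> closed [set p : R * R | A p.2].
    by move=> cA; apply: (preimage_closed (f := snd)) => // p _; exact: cvg_snd.
  rewrite (_ : circle R = (circle R `&` [set p | 0 <= p.2]) `|`
                          (circle R `&` [set p | p.2 <= 0])).
    apply: withinU_continuous.
    - apply: closedI; first exact: closed_circle.
      apply: (closed2 [set t | 0 <= t]); exact: closed_ge.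
    - apply: closedI; first exact: closed_circle.
      apply: (closed2 [set t | t <= 0]); exact: closed_le.
    - apply: (@within_eq _ _ _ (a \o c)); first by move=> p [_ /= p0]; rewrite /phi p0.
      apply: within_comp ca _; first exact: continuous_subspaceT.
      by move=> p [/c01 + _]; rewrite /= in_itv.
    - apply: (@within_eq _ _ _ (b \o c)); first by move=> p [pC /= p0]; rewrite phi_neg.
      apply: within_comp cb _; first exact: continuous_subspaceT.
      by move=> p [/c01 + _]; rewrite /= in_itv.
  apply/seteqP; split=> [p pC|p [[]|[]]//].
  by have /orP[h|h] := le_total 0 p.2; [left|right].
pose h x := xget (0, 0) [set p | circle R p /\ phi p = x].
have hphi p : circle R p -> h (phi p) = p.
  move=> pC; rewrite /h; case: xgetP => [q -> [qC /phi_inj]|/(_ p)]; first exact.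
  by case.
exists (phi @` circle R), h, phi; split => //.
- split.
  + by move=> _ [p pC <-]; rewrite hphi.
  + by move=> x y; rewrite !inE => -[p pC <-] [q qC <-]; rewrite !hphi// => ->.
  + by move=> p pC; exists (phi p); [exists p|exact: hphi].
- by move=> x; rewrite inE => -[p pC <-]; rewrite hphi.
- exact: (inverse_continuous hX compact_circle cphi hphi).
Qed.

End Circle.

(** * Attaching a segment to a tree *)

Section Segment.
Context {R : realType} {V : normedModType R}.

Definition line_point (u v : V) (t : R) : V := u + t *: (v - u).

Definition segment (u v : V) : set V := line_point u v @` `[0, 1].

Lemma line_point0 u v : line_point u v 0 = u.
Proof. by rewrite /line_point scale0r addr0. Qed.

Lemma line_point1 u v : line_point u v 1 = v.
Proof. by rewrite /line_point scale1r addrC subrK. Qed.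

Lemma line_point_continuous u v : continuous (line_point u v : R -> V).
Proof.
move=> t; apply: cvgD; first exact: cvg_cst.
by apply: cvgZr_tmp; exact: cvg_id.
Qed.

Lemma line_point_inj u v s t : u != v ->
  line_point u v s = line_point u v t -> s = t.
Proof.
move=> uv /addrI/eqP; rewrite -subr_eq0 -scalerBl scaler_eq0 !subr_eq0.
by rewrite (eq_sym v) (negbTE uv) orbF => /eqP.
Qed.

Lemma compact_segment u v : compact (segment u v).
Proof.
apply: continuous_compact; last exact: segment_compact.
by apply: continuous_subspaceT; exact: line_point_continuous.
Qed.

End Segment.

Section Attach.
Context {R : realType} {V : normedModType R} (S : set V) (D : V -> V -> R)
  (E : seq V) (u v : V) (hD : tree_metric S D E) (cS : closed S) (Su : S u)
  (uv : u != v) (Suv : S `&` segment u v `<=` [set u]).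

Local Notation pt := (line_point u v).
Local Notation S' := (S `|` segment u v).

(** The pair ([rho], [tau]) maps the enlarged tree into the product of [S] and the unit interval
    with the sum metric; its image is the union of the slice at height 0 and the fibre over [u]. The
    new edge gets length 1, whatever its norm. *)
Let rho x := if `[< S x >] then x else u.
Let tau x := if `[< S x >] then 0 else `|x - u| / `|v - u|.
Let D' x y := D (rho x) (rho y) + `|tau x - tau y|.

Let vu0 : 0 < `|v - u|. Proof. by rewrite normr_gt0 subr_eq0 eq_sym. Qed.

Let rhoS x : S x -> rho x = x. Proof. by rewrite /rho; case: asboolP. Qed.
Let tauS x : S x -> tau x = 0. Proof. by rewrite /tau; case: asboolP. Qed.
Let rhoNS x : ~ S x -> rho x = u. Proof. by rewrite /rho; case: asboolP. Qed.
Let tauNS x : ~ S x -> tau x = `|x - u| / `|v - u|.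
Proof. by rewrite /tau; case: asboolP. Qed.

Let pt_in t : 0 <= t <= 1 -> S' (pt t).
Proof. by move=> ht; right; exists t; rewrite //= in_itv. Qed.

Let pt_rho t : 0 <= t <= 1 -> rho (pt t) = u /\ tau (pt t) = t.
Proof.
move=> /[dup] ht /andP[t0 t1]; have [Sp|Sp] := pselect (S (pt t)); last first.
  rewrite rhoNS// tauNS// /line_point addrC addKr normrZ ger0_norm//.
  by rewrite mulfK// gt_eqF.
have /= pu : pt t = u by apply: Suv; split => //; exists t; rewrite //= in_itv.
rewrite rhoS// tauS// pu; split => //.
by apply: (line_point_inj uv); rewrite pu line_point0.
Qed.

Let S'P x : S' x -> (S x /\ rho x = x /\ tau x = 0) \/
  (~ S x /\ rho x = u /\ exists2 t, 0 <= t <= 1 & x = pt t /\ tau x = t).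
Proof.
have [Sx _|Sx [//|[t /= + ptx]]] := pselect (S x).
  by left; rewrite rhoS// tauS.
subst x; rewrite in_itv /= => ht; right; have [pr pt_] := pt_rho ht.
by split => //; split => //; exists t.
Qed.

Let S'rho x : S' x -> S (rho x).
Proof. by move=> /S'P[[Sx [-> _]]|[_ [-> _]]]. Qed.

Let S'tau x : S' x -> 0 <= tau x <= 1.
Proof. by move=> /S'P[[_ [_ ->]]|[_ [_ [t ht [_ ->]]]]]; rewrite ?lexx ?ler01. Qed.

Let S'or x : S' x -> tau x = 0 \/ rho x = u.
Proof. by move=> /S'P[[_ [_ ->]]|[_ [-> _]]]; [left|right]. Qed.

Let line_four (a b c d : R) : `|a - b| + `|c - d| <= `|a - c| + `|b - d| \/
  `|a - b| + `|c - d| <= `|a - d| + `|b - c|.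
Proof.
have h (x y : R) : (`|x - y| = x - y /\ y <= x) \/ (`|x - y| = y - x /\ x <= y).
  by have [xy|/ltW xy] := lerP y x; [left|right].
have := ler_norm (a - c); have := ler_norm (b - d); have := ler_norm (a - d).
have := ler_norm (b - c); have := ler_norm (c - a); have := ler_norm (d - b).
have := ler_norm (d - a); have := ler_norm (c - b).
rewrite (distrC c a) (distrC d b) (distrC d a) (distrC c b) => *.
have [[-> ?]|[-> ?]] := h a b; have [[-> ?]|[-> ?]] := h c d;
  have [ac|ac] := lerP a c; have [bd|bd] := lerP b d;
  (left; lra) || (right; lra).
Qed.

(** In a product, [S] and the line could satisfy the condition through different pairings. Here each
    point has height 0 or base point [u], and a case distinction on this makes the pairings
    agree. *)
Let four x y z w : S' x -> S' y -> S' z -> S' w ->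
  D' x y + D' z w <= D' x z + D' y w \/ D' x y + D' z w <= D' x w + D' y z.
Proof.
move=> hx hy hz hw; rewrite /D'.
have := S'tau hx; have := S'tau hy; have := S'tau hz; have := S'tau hw.
have := S'or hx; have := S'or hy; have := S'or hz; have := S'or hw.
move: (S'rho hx) (S'rho hy) (S'rho hz) (S'rho hw).
move: (rho x) (rho y) (rho z) (rho w) (tau x) (tau y) (tau z) (tau w).
move=> {hx hy hz hw x y z w} x y z w a b c d Sx Sy Sz Sw hw hz hy hx d01 c01 b01 a01.
have tr p q r : S p -> S q -> S r -> D p r <= D p q + D q r by exact: (tm_tri hD).
have f4 := tm_four hD Sx Sy Sz Sw; have l4 := line_four a b c d.
have C := tm_sym hD; have D0 := tm_refl hD u.
have nb (s t : R) : 0 <= s -> 0 <= t -> `|s - t| <= s + t.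
  by move=> s0 t0; rewrite (le_trans (ler_normB _ _))// !ger0_norm.
have n0 (s : R) : 0 <= s -> `|s - 0| = s by move=> s0; rewrite subr0 ger0_norm.
have n0' (s : R) : 0 <= s -> `|0 - s| = s by move=> s0; rewrite sub0r normrN ger0_norm.
have Cx := C x u; have Cy := C y u; have Cz := C z u; have Cw := C w u.
case: hx => hx; case: hy => hy; case: hz => hz; case: hw => hw; subst;
  rewrite ?subrr ?normr0 ?n0 ?n0' ?D0 in l4 *; lra || (left; lra) || (right; lra).
Qed.

Let D'_S_pt x s : S x -> 0 <= s <= 1 -> D' x (pt s) = D x u + s.
Proof.
move=> Sx hs; have [pr pta] := pt_rho hs; rewrite /D' pr pta rhoS// tauS//.
by rewrite sub0r normrN ger0_norm//; case/andP: hs.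
Qed.

Let D'_pt s t : 0 <= s <= 1 -> 0 <= t <= 1 -> D' (pt s) (pt t) = `|s - t|.
Proof.
move=> hs ht; have [ps ts] := pt_rho hs; have [pt_ tt_] := pt_rho ht.
by rewrite /D' ps pt_ ts tt_ (tm_refl hD) add0r.
Qed.

Let D'_S x y : S x -> S y -> D' x y = D x y.
Proof. by move=> Sx Sy; rewrite /D' !rhoS// !tauS// subrr normr0 addr0. Qed.

Let D'C x y : D' x y = D' y x.
Proof. by rewrite /D' (tm_sym hD) distrC. Qed.

Let S'cases x : S' x -> S x \/ ~ S x /\ exists2 t, 0 <= t <= 1 & x = pt t.
Proof. by move=> /S'P[[]|[? [_ [t ht [xt _]]]]]; [left|right; split => //; exists t]. Qed.

Let normE (a c : R) : 0 <= c -> a = c \/ a = - c -> `|a| = c.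
Proof. by move=> c0 [->|->]; rewrite ?normrN ger0_norm. Qed.

Let geo x y t : S' x -> S' y -> 0 <= t <= D' x y ->
  exists2 z, S' z & D' x z = t /\ D' z y = D' x y - t.
Proof.
have geo_Spt x' s t' : S x' -> 0 <= s <= 1 -> 0 <= t' <= D' x' (pt s) ->
    exists2 z, S' z & D' x' z = t' /\ D' z (pt s) = D' x' (pt s) - t'.
  move=> Sx hs; rewrite D'_S_pt// => ht.
  have [tx|tx] := lerP t' (D x' u).
    have [|z Sz [xz zu]] := tm_geo hD (t := t') Sx Su; first by rewrite tx; case/andP: ht => ->.
    by exists z; [left|rewrite D'_S// D'_S_pt// xz zu; split => //; lra].
  have hs' : 0 <= t' - D x' u <= 1 by lra.
  exists (pt (t' - D x' u)); first exact: pt_in.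
  by rewrite D'_S_pt// D'_pt//; split; [lra|rewrite distrC ger0_norm; lra].
move=> hx hy; have [Sx|[_ [s hs ->]]] := S'cases hx; have [Sy|[_ [s' hs' ->]]] := S'cases hy.
- rewrite D'_S// => /(tm_geo hD Sx Sy)[z Sz zP]; exists z; first by left.
  by rewrite !D'_S.
- exact: geo_Spt.
- rewrite D'C => ht.
  have [|z Sz [yz zx]] := geo_Spt y s (D' y (pt s) - t) Sy hs; first by lra.
  by exists z => //; rewrite D'C zx (D'C z) yz; split; lra.
- rewrite D'_pt// => ht; have [ss|ss] := lerP s s'.
    have e1 : `|s - s'| = s' - s by apply: normE; [lra|right; lra].
    rewrite e1 in ht *; have h : 0 <= s + t <= 1 by lra.
    exists (pt (s + t)); first exact: pt_in.
    by rewrite !D'_pt//; split; apply: normE; (lra || (right; lra)).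
  have e1 : `|s - s'| = s - s' by apply: normE; [lra|left; lra].
  rewrite e1 in ht *; have h : 0 <= s - t <= 1 by lra.
  exists (pt (s - t)); first exact: pt_in.
  by rewrite !D'_pt//; split; apply: normE; (lra || (left; lra)).
Qed.

Let sep x y : S' x -> S' y -> D' x y = 0 -> x = y.
Proof.
move=> hx hy; have [Sx|[nSx [s hs xs]]] := S'cases hx;
  have [Sy|[nSy [s' hs' ys]]] := S'cases hy.
- by rewrite D'_S//; exact: (tm_sep hD).
- rewrite ys D'_S_pt// => h; case: nSy; have := tm_ge0 hD Sx Su => xu.
  by rewrite ys (_ : s' = 0) ?line_point0//; lra.
- rewrite xs D'C D'_S_pt// => h; case: nSx; have := tm_ge0 hD Sy Su => xu.
  by rewrite xs (_ : s = 0) ?line_point0//; lra.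
- by rewrite xs ys D'_pt// => /normr0_eq0/eqP; rewrite subr_eq0 => /eqP ->.
Qed.

Let closed_seg : closed (segment u v).
Proof. by apply: compact_closed; [exact: norm_hausdorff|exact: compact_segment]. Qed.

Let tau_pt t : 0 <= t <= 1 -> t = `|pt t - u| / `|v - u|.
Proof.
move=> /andP[t0 _]; rewrite /line_point addrC addKr normrZ ger0_norm//.
by rewrite mulfK// gt_eqF.
Qed.

Let near_line (x : V) (e : R) : 0 < e -> \forall y \near x, `|x - y| / `|v - u| < e.
Proof.
move=> e0; have e1 : 0 < e * `|v - u| by rewrite mulr_gt0.
have := nbhsx_ballx x _ e1; apply: filterS => y.
by rewrite -ball_normE /= => xy; rewrite ltr_pdivrMr.
Qed.

Let cont (x : V) (e : R) : S' x -> 0 < e -> \forall y \near x, S' y -> D' x y < e.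
Proof.
move=> hx e0; have [Sx|[nSx [s hs xs]]] := S'cases hx; last first.
  have nS : \forall y \near x, ~ S y.
    by apply: (open_nbhs_nbhs (A := ~` S)); split; rewrite // openC.
  near=> y => hy; have [Sy|[_ [t ht yt]]] := S'cases hy.
    by exfalso; move: Sy; near: y.
  rewrite xs yt D'_pt//.
  have -> : `|s - t| = `|x - y| / `|v - u|.
    rewrite xs yt /line_point opprD addrACA subrr add0r -scalerBl normrZ.
    by rewrite mulfK// gt_eqF.
  by near: y; exact: near_line.
have cS' := tm_cont hD Sx e0.
have [xu|xu] := pselect (x = u).
  near=> y => hy; have [Sy|[_ [t ht yt]]] := S'cases hy.
    by rewrite D'_S//; move: Sy; near: y.
  rewrite yt D'_S_pt// {1}xu (tm_refl hD) add0r (tau_pt ht) -yt.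
  rewrite (_ : `|y - u| = `|x - y|); last by rewrite xu distrC.
  by near: y; exact: near_line.
have ns : \forall y \near x, ~ segment u v y.
  apply: (open_nbhs_nbhs (A := ~` segment u v)); split; first by rewrite openC.
  by move=> sx; apply: xu; apply: Suv.
near=> y => -[Sy|sy]; first by rewrite D'_S//; move: Sy; near: y.
by exfalso; move: sy; near: y.
Unshelve. all: by end_near. Qed.

(** The list of ends may be redundant, it only has to be finite. The base [u] is added because it
    prolongs a segment which starts inside the new edge and runs back towards [u]. *)
Lemma tree_metric_attach : exists D0 : V -> V -> R, tree_metric S' D0 (u :: v :: E).
Proof.
have v_in : S' v by right; exists 1; rewrite ?line_point1//= in_itv /= lexx ler01.
have h01 : 0 <= (0 : R) <= 1 by lra.
have h11 : 0 <= (1 : R) <= 1 by lra.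
exists D'; split => //.
- by move=> x; rewrite /D' (tm_refl hD) subrr normr0 addr0.
- move=> e; rewrite !inE => /orP[/eqP ->|/orP[/eqP ->|/(tm_endsS hD)]]; last by left.
    by left.
  exact: v_in.
move=> b x hb hx; have [Sb|[_ [s hs ->]]] := S'cases hb;
  have [Sx|[_ [t ht ->]]] := S'cases hx.
- have [e eE be] := tm_ends hD Sb Sx; exists e; first by rewrite !inE eE !orbT.
  by have Se := tm_endsS hD eE; rewrite !D'_S.
- exists (pt 1); first by rewrite line_point1 !inE eqxx orbT.
  rewrite (D'_S_pt Sb ht) (D'_S_pt Sb h11) (D'_pt ht h11) (normE (c := 1 - t));
    (lra || (right; lra)).
- have [e eE be] := tm_ends hD Su Sx; exists e; first by rewrite !inE eE !orbT.
  have Se := tm_endsS hD eE.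
  rewrite (D'_S Sx Se) !(D'C (pt s)) (D'_S_pt Sx hs) (D'_S_pt Se hs).
  by rewrite (tm_sym hD x) (tm_sym hD e); lra.
- have [st|st] := lerP s t.
    exists (pt 1); first by rewrite line_point1 !inE eqxx orbT.
    rewrite !D'_pt// (normE (a := s - t) (c := t - s))
      ?(normE (a := t - 1) (c := 1 - t)) ?(normE (a := s - 1) (c := 1 - s));
      (lra || (right; lra)).
  exists (pt 0); first by rewrite line_point0 !inE eqxx.
  rewrite !D'_pt// (normE (a := s - t) (c := s - t))
    ?(normE (a := t - 0) (c := t)) ?(normE (a := s - 0) (c := s));
    (lra || (left; lra)).
Qed.

End Attach.

(** * Trees given by simplicial complexes *)

Section Simplices.
Context {R : realType} {n : nat}.
Local Notation V := 'rV[R]_n.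
Implicit Types (u v x : V) (s t : {fset V}) (F K : {fset {fset V}}).

Lemma simplex0 : simplex (fset0 : {fset V}) = set0.
Proof.
apply/seteqP; split=> // x [a [_ + _]]; rewrite big_seq_fset0 => /eqP.
by rewrite eq_sym oner_eq0.
Qed.

Lemma simplex1 u : simplex [fset u]%fset = [set u].
Proof.
apply/seteqP; split=> x /=.
  by move=> [a [_ + ->]]; rewrite !big_seq_fset1 => ->; rewrite scale1r.
by move=> ->; exists (fun=> 1); rewrite !big_seq_fset1 scale1r; split.
Qed.

Lemma simplex2 u v : u != v -> simplex [fset u; v]%fset = segment u v.
Proof.
move=> uv; have sumE (W : zmodType) (F : V -> W) :
    \sum_(w <- [fset u; v]%fset) F w = F u + F v.
  by rewrite big_fsetU1 ?inE//= big_seq_fset1.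
apply/seteqP; split=> x.
  move=> [a [a0 + ->]]; rewrite !sumE => a1; exists (a v).
    have := a0 u; have := a0 v; rewrite !inE !eqxx orbT /= in_itv /= => /(_ isT) av /(_ isT) au.
    by apply/andP; split; lra.
  have -> : a u = 1 - a v by lra.
  by rewrite /line_point scalerBl scale1r scalerBr addrAC addrA.
move=> [t /=]; rewrite in_itv /= => ht <-.
exists (fun w => if w == v then t else 1 - t); rewrite !sumE eqxx (negbTE uv).
split.
- by move=> w _; case: ifP => _; lra.
- by rewrite subrK.
- by rewrite /line_point scalerBl scale1r scalerBr addrAC addrA.
Qed.

Lemma carrierU1 s F : carrier (s |` F)%fset = simplex s `|` carrier F.
Proof.
apply/seteqP; split=> x.
  by move=> [t]; rewrite !inE => /orP[/eqP ->|tF] tx; [left|right; exists t].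
by move=> [sx|[t tF tx]]; [exists s|exists t] => //; rewrite !inE ?eqxx ?tF ?orbT.
Qed.

Lemma simplex_shape s : s != fset0 -> (#|` s| <= 2)%N ->
  (exists u, s = [fset u]%fset) \/ exists u v, u != v /\ s = [fset u; v]%fset.
Proof.
move=> /fset0Pn[u us]; rewrite (cardfsD1 u) us add1n ltnS => s1.
have sE : s = (u |` (s `\ u))%fset by rewrite fsetD1K.
have [s0|/fset0Pn[v vs]] := eqVneq (s `\ u)%fset fset0.
  by left; exists u; rewrite sE s0 fsetU0.
right; exists u, v; split.
  by move: vs; rewrite !inE eq_sym => /andP[].
rewrite {1}sE; congr (_ `|` _)%fset; apply/esym/eqP.
by rewrite eqEfcard fsub1set vs cardfs1.
Qed.

Lemma simplex_compact s : s != fset0 -> (#|` s| <= 2)%N -> compact (simplex s).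
Proof.
move=> s0 s2; have [[u ->]|[u [v [uv ->]]]] := simplex_shape s0 s2.
  by rewrite simplex1; exact: compact_set1.
by rewrite simplex2//; exact: compact_segment.
Qed.

Lemma vertex_simplex s u : (#|` s| <= 2)%N -> u \in s -> simplex s u.
Proof.
move=> s2 us; have s0 : s != fset0 by apply/fset0Pn; exists u.
have [[w sE]|[w [v [wv sE]]]] := simplex_shape s0 s2; move: us; rewrite sE !inE.
  by move=> /eqP ->; rewrite simplex1.
rewrite simplex2// => /orP[/eqP ->|/eqP ->].
  by exists 0; rewrite ?line_point0//= in_itv /= lexx ler01.
by exists 1; rewrite ?line_point1//= in_itv /= lexx ler01.
Qed.

Lemma carrier_compact F : (forall s, s \in F -> s != fset0 /\ (#|` s| <= 2)%N) ->
  compact (carrier F).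
Proof.
move=> hF; rewrite (_ : carrier F = \bigcup_(s in [set` F]) simplex s).
  rewrite bigcup_seq big_seq; apply: bigsetU_compact => s /hF[s0 s2].
  exact: simplex_compact.
by apply/seteqP; split=> x [s sF sx]; exists s.
Qed.

(** * Growing a subcomplex edge by edge *)

Section Growth.
Context {T : topologicalType} (hT : hausdorff_space T) (K : {fset {fset V}})
  (cK : simplicial_complex K) (K2 : forall s, s \in K -> (#|` s| <= 2)%N)
  (conK : connected (carrier K)) (g : V -> T)
  (cg : {within carrier K, continuous g})
  (gI : forall x y, carrier K x -> carrier K y -> g x = g y -> x = y)
  (noC : ~ exists C : set T, homeomorphic C (circle R)).

Let K0 s : s \in K -> s != fset0. Proof. by have [h _ _] := cK; move=> /h[]. Qed.

Let subset_carrier F : (F `<=` K)%fset -> carrier F `<=` carrier K.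
Proof. by move=> /fsubsetP FK x [s sF sx]; exists s => //; exact: FK. Qed.

Let compact_sub F : (F `<=` K)%fset -> compact (carrier F).
Proof.
move=> /fsubsetP FK; apply: carrier_compact => s /FK sK.
by split; [exact: K0|exact: K2].
Qed.

Let closed_sub F : (F `<=` K)%fset -> closed (carrier F).
Proof. by move=> FK; apply: compact_closed; [exact: norm_hausdorff|exact: compact_sub]. Qed.

Let closed_faces F := forall s t, s \in F -> (t `<=` s)%fset -> t != fset0 -> t \in F.

(** The geodesic of [F] from [u] to [v] and the segment form a circle, carried to [T] by the
    injection [g]: the exclusion of circles is a hypothesis on [T], not on the complex. *)
Let no_chord F (D : V -> V -> R) E u v : (F `<=` K)%fset -> tree_metric (carrier F) D E ->
  u != v -> carrier F u -> carrier F v -> segment u v `<=` carrier K ->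
  ~ (carrier F `&` segment u v `<=` [set u; v]).
Proof.
move=> FK hD uv Fu Fv uvK inter; apply: noC.
have FKc := subset_carrier FK.
have [c [c0 cL cS cD]] := tm_geodesic hD Fu Fv.
have L0 : 0 < D u v.
  rewrite lt_neqAle (tm_ge0 hD)// andbT; apply/eqP => /esym/(tm_sep hD Fu Fv) uv'.
  by rewrite uv' eqxx in uv.
have cF (t : R) : 0 <= t <= D u v -> carrier F (c t) by move=> /cS[].
have cc := tm_geodesic_continuous hD (compact_sub FK) cF cD.
have sc (t : R) : 0 <= t <= 1 -> 0 <= t * D u v <= D u v by move=> ht; apply/andP; split; nra.
have scc : {within `[0, 1]%classic, continuous (fun t : R => t * D u v)}.
  by apply: continuous_subspaceT => t; apply: cvgM; [exact: cvg_id|exact: cvg_cst].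
apply: (homeomorphic_circle hT (a := g \o (c \o (fun t : R => t * D u v)))
  (b := g \o line_point u v)).
- apply: (within_comp _ cg) => [|t /=]; last by rewrite in_itv /= => /sc/cF/FKc.
  by apply: (within_comp scc cc) => t; rewrite /= !in_itv /=; exact: sc.
- apply: (within_comp _ cg) => [|t t01]; last by apply: uvK; exists t.
  by apply: continuous_subspaceT; exact: line_point_continuous.
- by rewrite /= mul0r c0 line_point0.
- by rewrite /= mul1r cL line_point1.
- move=> s t hs ht /gI-/(_ (FKc _ (cF _ (sc _ hs))) (FKc _ (cF _ (sc _ ht)))) /= cst.
  have := cD _ _ (sc _ hs) (sc _ ht); rewrite cst (tm_refl hD) => /esym/normr0_eq0.
  by rewrite -mulrBl => /eqP; rewrite mulf_eq0 (gt_eqF L0) orbF subr_eq0 => /eqP.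
- move=> s t hs ht /gI st; apply: (line_point_inj uv); apply: st.
    by apply: uvK; exists s; rewrite //= in_itv.
  by apply: uvK; exists t; rewrite //= in_itv.
move=> s t hs ht /gI-/(_ (FKc _ (cF _ (sc _ hs)))) st.
have st' : c (s * D u v) = line_point u v t.
  by apply: st; apply: uvK; exists t; rewrite //= in_itv.
have h0 : 0 <= (0 : R) <= D u v by lra.
have hL : 0 <= D u v <= D u v by lra.
have [|su|sv] := inter (c (s * D u v)).
- by split; [exact/cF/sc|exists t; rewrite //= in_itv].
- left; have := cD _ _ (sc _ hs) h0; rewrite su c0 (tm_refl hD) subr0.
  move=> /esym/normr0_eq0/eqP; rewrite mulf_eq0 (gt_eqF L0) orbF.
  by move=> /eqP.
- right; have := cD _ _ (sc _ hs) hL; rewrite sv cL (tm_refl hD).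
  rewrite -{2}[D u v]mul1r -mulrBl => /esym/normr0_eq0/eqP.
  by rewrite mulf_eq0 (gt_eqF L0) orbF subr_eq0 => /eqP.
Qed.

(** Induction on the number of simplices outside [F]. By connectedness a simplex of [F] meets one
    outside [F]; they share a vertex [u], so the latter is an edge from [u] to some [v]. If [v]
    belonged to [F], this edge would be a chord; hence it can be attached at [u]. *)
Let grow k F : (F `<=` K)%fset -> F != fset0 -> closed_faces F ->
  (exists (D : V -> V -> R) E, tree_metric (carrier F) D E) ->
  (#|` (K `\` F)%fset| <= k)%N ->
  exists (D : V -> V -> R) E, tree_metric (carrier K) D E.
Proof.
have [_ faceK interK] := cK.
elim: k F => [|k IH] F FK F0 fF hF KFk.
  suff -> : K = F by [].
  apply/eqP; rewrite eqEfsubset FK andbT -fsetD_eq0 -cardfs_eq0.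
  by rewrite -leqn0.
have [KF|/fset0Pn[t0]] := eqVneq (K `\` F)%fset fset0.
  by apply: (IH F) => //; rewrite KF cardfs0.
have QK : (K `\` F `<=` K)%fset by exact: fsubsetDl.
have carrier_ne G s : (G `<=` K)%fset -> s \in G -> carrier G !=set0.
  move=> /fsubsetP GK sG; have /fset0Pn[u us] := K0 (GK _ sG).
  by exists u, s => //; apply: vertex_simplex => //; exact/K2/GK.
move=> /(carrier_ne _ _ QK) Qne.
have Pne : carrier F !=set0 by have /fset0Pn[s /(carrier_ne _ _ FK)] := F0.
have PQ x : carrier K x -> carrier F x \/ carrier (K `\` F)%fset x.
  move=> [s sK sx]; have [sF|sF] := boolP (s \in F); first by left; exists s.
  by right; exists s => //; rewrite !inE sF.
have [x [[s sF sx] [t + tx]]] : carrier F `&` carrier (K `\` F)%fset !=set0.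
  apply/set0P/negP => /eqP PQ0; have [y Qy] := Qne.
  suff PK : carrier F = carrier K.
    have : (carrier F `&` carrier (K `\` F)%fset) y.
      by split => //; rewrite PK; exact: subset_carrier Qy.
    by rewrite PQ0.
  apply: conK => //.
    exists (~` carrier (K `\` F)%fset); first by rewrite openC; exact: closed_sub.
    apply/seteqP; split=> z.
      move=> Fz; split; first exact: subset_carrier Fz.
      by move=> Qz; have : (carrier F `&` carrier (K `\` F)%fset) z by []; rewrite PQ0.
    by move=> [/PQ[]].
  exists (carrier F); first exact: closed_sub.
  by apply/esym/setIidr; exact: subset_carrier.
rewrite !inE => /andP[tF tK].
have sK : s \in K by move/fsubsetP : FK; exact.
have : simplex (s `&` t)%fset x by rewrite -interK.
have [->|/fset0Pn[u]] := eqVneq (s `&` t)%fset fset0; first by rewrite simplex0.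
rewrite !inE => /andP[us ut] _.
have uF : [fset u]%fset \in F.
  apply: (fF s) => //; first by rewrite fsub1set.
  by apply/fset0Pn; exists u; rewrite !inE.
have [v [uv tE]] : exists v, u != v /\ t = [fset u; v]%fset.
  have [[w tw]|[a [b [ab tab]]]] := simplex_shape (K0 tK) (K2 tK).
    case/negP: tF; move: ut; rewrite tw !inE => /eqP uw; by rewrite -uw.
  move: ut; rewrite tab !inE => /orP[/eqP ->|/eqP ->]; first by exists b.
  by exists a; rewrite eq_sym ab fsetUC.
have stE : simplex t = segment u v by rewrite tE simplex2.
have Fu : carrier F u by exists [fset u]%fset => //; rewrite simplex1.
have uvK : segment u v `<=` carrier K by rewrite -stE => y ty; exists t.
have inter y : carrier F y -> segment u v y -> y = u \/ y = v /\ [fset v]%fset \in F.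
  move=> [r rF ry]; rewrite -stE => ty.
  have rK : r \in K by move/fsubsetP : FK; exact.
  have : simplex (r `&` t)%fset y by rewrite -interK.
  have nrt : ~~ (t `<=` r)%fset.
    by apply: contra tF => tr; apply: (fF r) => //; exact: K0.
  have [ur|ur] := boolP (u \in r); have [vr|vr] := boolP (v \in r).
  - case/negP: nrt; rewrite tE; apply/fsubsetP => z.
    by rewrite !inE => /orP[/eqP ->|/eqP ->].
  - rewrite (_ : (r `&` t)%fset = [fset u]%fset) ?simplex1; first by left.
    apply/fsetP => z; rewrite tE !inE; have [->|zu] := eqVneq z u; first by rewrite ur.
    by have [->|zv] := eqVneq z v; rewrite ?(negbTE vr)//= andbF.
  - rewrite (_ : (r `&` t)%fset = [fset v]%fset) ?simplex1.
      right; split => //; apply: (fF r) => //; first by rewrite fsub1set.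
      by apply/fset0Pn; exists v; rewrite !inE.
    apply/fsetP => z; rewrite tE !inE; have [->|zv] := eqVneq z v; first by rewrite vr orbT.
    by have [->|zu] := eqVneq z u; rewrite ?(negbTE ur)//= andbF.
  - rewrite (_ : (r `&` t)%fset = fset0) ?simplex0//.
    apply/fsetP => z; rewrite tE !inE; have [->|zv] := eqVneq z v; first by rewrite (negbTE vr).
    by have [->|zu] := eqVneq z u; rewrite ?(negbTE ur)//= andbF.
have [D [E hD]] := hF.
have [vF|vF] := boolP ([fset v]%fset \in F).
  have Fv : carrier F v by exists [fset v]%fset => //; rewrite simplex1.
  exfalso; apply: (no_chord FK hD uv Fu Fv uvK) => y [Fy /(inter _ Fy)].
  by move=> [->|[-> _]]; [left|right].
have Suv : carrier F `&` segment u v `<=` [set u].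
  move=> y [Fy /(inter _ Fy)[->//|[_ vF']]].
  by rewrite vF' in vF.
have [D' hD'] := tree_metric_attach hD (closed_sub FK) Fu uv Suv.
have vK : [fset v]%fset \in K.
  apply: (faceK t) => //; first by rewrite fsub1set tE !inE eqxx orbT.
  by apply/fset0Pn; exists v; rewrite !inE.
pose F' := (t |` ([fset v] |` F))%fset.
have F'K : (F' `<=` K)%fset.
  by apply/fsubsetP => r; rewrite !inE => /orP[/eqP ->|/orP[/eqP ->|/(fsubsetP FK)]].
apply: (IH F') => //.
- by apply/fset0Pn; exists t; rewrite !inE eqxx.
- move=> r q; rewrite !inE => /orP[/eqP ->|/orP[/eqP ->|rF]] qr q0; last first.
  + by rewrite (fF r q) ?orbT.
  + move: qr; rewrite fsubset1 (negbTE q0) orbF => /eqP ->.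
    by rewrite eqxx orbT.
  have [uq|uq] := boolP (u \in q); have [vq|vq] := boolP (v \in q).
  + suff -> : q = t by rewrite eqxx.
    apply/eqP; rewrite eqEfsubset qr tE /=; apply/fsubsetP => z.
    by rewrite !inE => /orP[/eqP ->|/eqP ->].
  + suff -> : q = [fset u]%fset by rewrite uF !orbT.
    apply/fsetP => z; rewrite !inE; have [->|zu] := eqVneq z u; first by rewrite uq.
    apply/negP => zq; move/fsubsetP/(_ z zq) : qr; rewrite tE !inE (negbTE zu) /=.
    by move=> /eqP zv; rewrite zv (negbTE vq) in zq.
  + suff -> : q = [fset v]%fset by rewrite eqxx orbT.
    apply/fsetP => z; rewrite !inE; have [->|zv] := eqVneq z v; first by rewrite vq.
    apply/negP => zq; move/fsubsetP/(_ z zq) : qr; rewrite tE !inE (negbTE zv) orbF.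
    by move=> /eqP zu; rewrite zu (negbTE uq) in zq.
  + have /fset0Pn[z zq] := q0; move/fsubsetP/(_ z zq) : qr; rewrite tE !inE.
    by move=> /orP[/eqP zu|/eqP zv]; rewrite ?zu ?zv ?(negbTE uq) ?(negbTE vq) in zq.
- exists D', (u :: v :: E); rewrite (_ : carrier F' = carrier F `|` segment u v)//.
  rewrite !carrierU1 stE simplex1; apply/seteqP; split=> y.
    move=> [|[->|]]; [by right| |by left]; right.
    by exists 1; rewrite ?line_point1//= in_itv /= lexx ler01.
  by move=> [?|?]; [right; right|left].
- rewrite -ltnS; apply: leq_trans KFk; apply: fproper_ltn_card.
  rewrite fproperE; apply/andP; split.
    by apply/fsubsetP => r; rewrite !inE !negb_or => /andP[/and3P[_ _ ->]].
  by apply/negP => /fsubsetP/(_ t); rewrite !inE eqxx tF tK => /(_ isT).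
Qed.

Lemma complex_tree_metric : K != fset0 ->
  exists (D : V -> V -> R) E, tree_metric (carrier K) D E.
Proof.
have [_ faceK _] := cK.
move=> /fset0Pn[s sK]; have /fset0Pn[u us] := K0 sK.
have u0 : [fset u]%fset != fset0 by apply/fset0Pn; exists u; rewrite !inE.
have uK : [fset u]%fset \in K by apply: (faceK s) => //; rewrite fsub1set.
apply: (@grow #|` K|%fset [fset [fset u]%fset]%fset).
- by rewrite fsub1set.
- by apply/fset0Pn; exists [fset u]%fset; rewrite !inE.
- move=> r t; rewrite !inE => /eqP -> ; rewrite fsubset1 => /orP[//|/eqP ->].
  by rewrite eqxx.
- exists (fun _ _ => 0), [:: u].
  have -> : carrier [fset [fset u]]%fset = [set u].
    apply/seteqP; split=> x; first by move=> [r]; rewrite inE => /eqP ->; rewrite simplex1.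
    by move=> ->; exists [fset u]%fset; rewrite ?inE// simplex1.
  split => //.
  + by move=> x y -> ->.
  + by move=> x y z w _ _ _ _; left.
  + by move=> x y t _ _ /andP[t0 t1]; exists u => //; split; lra.
  + by move=> x e _ e0; near=> y.
  + by move=> e; rewrite inE => /eqP.
  + by move=> b x _ _; exists u; rewrite ?inE// addr0.
- by apply: fsubset_leq_card; exact: fsubsetDl.
Unshelve. all: by end_near. Qed.

End Growth.
End Simplices.

Lemma topological_tree_metric {R : realType} (T : metricType R) :
  topological_tree T ->
  exists (D : T -> T -> R) E, tree_metric [set: T] D E.
Proof.
move=> [[cT kT [n [K [cK dimK [h [g [hbij hK ch cg]]]]]]] noC].
have [hin hinj hsurj] := hbij.
have hg x : carrier K x -> h (g x) = x.
  by move=> /hsurj[t _ <-]; rewrite hK// inE.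
have hgK t : g (h t) = t by rewrite hK// inE.
have hT : h @` [set: T] = carrier K.
  by apply/seteqP; split=> [_ [t _ <-]|x /hsurj]; [exact: hin|].
have conK : connected (carrier K) by rewrite -hT; exact: connected_continuous_connected.
have K2 s : s \in K -> (#|` s| <= 2)%N.
  move=> sK; have : (#|` s|.-1 <= complex_dim K)%N by exact: leq_bigmax_seq.
  rewrite dimK.
  by case: #|` s|%fset.
(* The maximum over the empty complex is 0, so dimension 1 excludes it. *)
have K0 : K != fset0.
  by apply/eqP => K0; move: dimK; rewrite /complex_dim K0 big_seq_fset0.
have gI x y : carrier K x -> carrier K y -> g x = g y -> x = y.
  by move=> Kx Ky /(congr1 h); rewrite !hg.
have [D [E hD]] := complex_tree_metric (@metric_hausdorff _ T) cK K2 conK cg gI noC K0.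
exists (fun x y => D (h x) (h y)), (map g E).
have Kh t : carrier K (h t) by exact: hin.
split.
- by move=> x; rewrite (tm_refl hD).
- by move=> x y; exact: (tm_sym hD).
- by move=> x y _ _ /(tm_sep hD (Kh x) (Kh y)) /(congr1 g); rewrite !hgK.
- by move=> x y z w _ _ _ _; exact: (tm_four hD).
- move=> x y t _ _ /(tm_geo hD (Kh x) (Kh y))[z Kz zP].
  by exists (g z); rewrite ?hg.
- move=> x e _ e0; have ch' : continuous h by apply/continuous_subspace_setT.
  have : nbhs x (fun y => carrier K (h y) -> D (h x) (h y) < e) :=
    ch' x _ (tm_cont hD (Kh x) e0).
  by apply: filterS => y hy _; exact/hy/Kh.
- by [].
- move=> b x _ _; have [e eE be] := tm_ends hD (Kh b) (Kh x).
  exists (g e); first exact: map_f.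
  by rewrite hg//; exact: (tm_endsS hD eE).
Qed.

(** * Recurrence in metric spaces *)

Section MetricLemmas.
Context {R : realType} {X : metricType R}.
Implicit Types x y : X.

Lemma nbhs_mdist x (U : set X) : nbhs x U <->
  exists2 e : R, 0 < e & forall y, mdist x y < e -> U y.
Proof.
split=> [/nbhs_ballP[e e0 eU]|[e e0 eU]].
  by exists e => // y xy; apply: eU; rewrite ballEmdist.
by apply/nbhs_ballP; exists e => // y; rewrite ballEmdist => /eU.
Qed.

Lemma closure_mdist (A : set X) x : closure A x <->
  forall e : R, 0 < e -> exists2 y, A y & mdist x y < e.
Proof.
split=> [Ax e e0|Ax U /nbhs_mdist[e e0 eU]].
  have [|y [Ay xy]] := Ax [set y | mdist x y < e]; last by exists y.
  by apply/nbhs_mdist; exists e.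
by have [y Ay xy] := Ax e e0; exists y; split => //; exact: eU.
Qed.

Lemma mdist_continuous x : continuous (mdist x : X -> R^o).
Proof.
move=> y; apply/cvgrPdist_lt => e e0; apply/nbhs_mdist; exists e => // z yz.
have := metric_triangle x y z; have := metric_triangle x z y.
rewrite (metric_sym z y) => h1 h2; rewrite ltr_norml.
by apply/andP; split; lra.
Qed.

Lemma continuous_mdist (F : X -> X) : continuous F -> forall x (e : R), 0 < e ->
  exists2 d : R, 0 < d & forall y, mdist x y < d -> mdist (F x) (F y) < e.
Proof.
move=> cF x e e0; apply/nbhs_mdist; apply: (cF x [set z | mdist (F x) z < e]).
by apply/nbhs_mdist; exists e.
Qed.

(** A Lebesgue number argument: counterexamples for radii tending to 0 would cluster at a point
    around which one radius works. *)
Lemma compact_mdist (K : set X) (P : R -> X -> Prop) : compact K ->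
  (forall d d' x, d' <= d -> P d x -> P d' x) ->
  (forall x, K x -> exists2 d : R, 0 < d & forall y, mdist x y < d -> P d y) ->
  exists2 d : R, 0 < d & forall x, K x -> P d x.
Proof.
move=> cK mP locP; apply: contrapT => NP.
have Nn (n : nat) : exists x, K x /\ ~ P n.+1%:R^-1 x.
  apply: contrapT => H; apply: NP; exists n.+1%:R^-1; first by rewrite invr_gt0.
  by move=> x Kx; apply: contrapT => Px; apply: H; exists x.
have [u uP] := choice Nn.
have [a [Ka clua]] : K `&` cluster (u n @[n --> \oo]) !=set0.
  by apply: cK; exists 0%N => // n _; have [] := uP n.
have [d d0 dP] := locP a Ka.
have [N Nd] : exists N : nat, forall n, (N <= n)%N -> n.+1%:R^-1 < d.
  by have [N _ NP'] := near_infty_natSinv_lt (PosNum d0); exists N.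
have [] := clua (u @` [set n | (N <= n)%N]) [set y | mdist a y < d].
- by exists N => // n Nn'; exists n.
- by apply/nbhs_mdist; exists d.
move=> _ [[n /= Nn' <-] /= /dP an]; have [_] := uP n; apply.
by apply: mP an; exact/ltW/Nd.
Qed.

Lemma compact_mdist_lt (A Q : set X) : compact A -> closed Q ->
  A `&` Q = set0 ->
  exists2 e : R, 0 < e & forall a q, A a -> Q q -> e <= mdist a q.
Proof.
move=> cA cQ AQ.
have [|a Aa|e e0 eP] := @compact_mdist A
    (fun e a => forall q, Q q -> e <= mdist a q) cA.
- by move=> d d' x dd' h q Qq; exact: le_trans (h q Qq).
- have Qa : ~ Q a by move=> Qa; have : (A `&` Q) a by []; rewrite AQ.
  have /nbhs_mdist[e e0 eQ] : nbhs a (~` Q).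
    by apply: open_nbhs_nbhs; split => //; rewrite openC.
  exists (e / 2) => [|y ay q Qq]; first by rewrite divr_gt0.
  have : e <= mdist a q by rewrite leNgt; apply/negP => /eQ.
  by have := metric_triangle a y q; lra.
by exists e => // a q Aa; exact: eP.
Qed.

Lemma compact_unif_continuous (A : set X) (F : X -> X) (e : R) : continuous F ->
  compact A -> 0 < e ->
  exists2 d : R, 0 < d & forall a y, A a -> mdist a y < d -> mdist (F a) (F y) < e.
Proof.
move=> cF cA e0.
have [|a Aa|d d0 dP] := @compact_mdist A
    (fun d a => forall y, mdist a y < d -> mdist (F a) (F y) < e) cA.
- by move=> d d' x dd' h y xy; apply: h; exact: lt_le_trans dd'.
- have e20 : 0 < e / 2 by rewrite divr_gt0.
  have [d d0 dP] := continuous_mdist cF a e20.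
  exists (d / 2) => [|x ax y xy]; first by rewrite divr_gt0.
  have /dP : mdist a x < d by lra.
  have /dP : mdist a y < d by have := metric_triangle a x y; lra.
  have := metric_triangle (F x) (F a) (F y); rewrite (metric_sym (F x) (F a)); lra.
by exists d => // a y Aa; exact: dP.
Qed.

Lemma fixed_by_approximation (F : X -> X) x :
  continuous F ->
  (forall e : R, 0 < e -> exists2 y, mdist x y < e & F y = y) -> F x = x.
Proof.
move=> cF xF; apply: mdist_positivity; apply/eqP; rewrite eq_le mdist_ge0 andbT.
apply/ler_addgt0Pr => e e0; rewrite add0r.
have e20 : 0 < e / 2 by rewrite divr_gt0.
have [d d0 dP] := continuous_mdist cF x e20.
have de0 : 0 < Num.min d (e / 2) by rewrite lt_min d0.
have [y] := xF _ de0; rewrite lt_min => /andP[/dP + xy].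
move=> + Fy; rewrite Fy => h; have := metric_triangle (F x) y x.
by rewrite (metric_sym y); lra.
Qed.

End MetricLemmas.

Section Recurrence.
Context {R : realType} {X : metricType R} (F : X -> X).
Implicit Types x y : X.

Lemma RecP x : Rec F x <-> forall e : R, 0 < e -> forall n,
  exists2 m, (n <= m)%N & mdist x (iter m F x) < e.
Proof.
split=> [xx e e0 n|xx A B [N _ NA] /nbhs_mdist[e e0 eB]].
  have [] := xx ((fun m => iter m F x) @` [set m | (n <= m)%N]) [set y | mdist x y < e].
  - by exists n => // m nm; exists m.
  - by apply/nbhs_mdist; exists e.
  by move=> _ [[m /= nm <-] xm]; exists m.
have [m Nm xm] := xx e e0 N.
by exists (iter m F x); split; [exact: NA|exact: eB].
Qed.

Lemma Per_Rec x : Per F x -> Rec F x.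
Proof.
move=> [n n0 nx]; apply/RecP => e e0 m.
exists (m * n)%N; first by rewrite leq_pmulr.
suff -> : iter (m * n) F x = x by rewrite mdistxx.
by elim: m => [//|m IH]; rewrite mulSn iterD IH.
Qed.

End Recurrence.

Section ContinuousRecurrence.
Context {R : realType} {X : metricType R} (F : X -> X) (cF : continuous F).
Implicit Types x y : X.

Lemma continuous_iter n : continuous (iter n F).
Proof.
by elim: n => [|n IH] x; [exact: cvg_id|apply: continuous_comp; [exact: IH|exact: cF]].
Qed.

Lemma Rec_iter n x : Rec F x -> Rec F (iter n F x).
Proof.
move=> /RecP xx; apply/RecP => e e0 m.
have [d d0 dP] := continuous_mdist (@continuous_iter n) x e0.
by have [k mk xk] := xx d d0 m; exists k => //; rewrite -iterD addnC iterD; exact: dP.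
Qed.

Section Pow.
Variable n : nat.
Hypothesis n0 : (0 < n)%N.

(** [v] belongs to the omega-limit set of [u] under [iter n F]. *)
Let to u v := forall e : R, 0 < e -> forall N,
  exists2 k, (N <= k)%N & mdist v (iter (k * n) F u) < e.

Let to_iter i u v : to u v -> to (iter i F u) (iter i F v).
Proof.
move=> uv e e0 N.
have [d d0 dP] := continuous_mdist (@continuous_iter i) v e0.
by have [k Nk vk] := uv d d0 N; exists k => //; rewrite -iterD addnC iterD; exact: dP.
Qed.

Let to_trans v u w : to u v -> to v w -> to u w.
Proof.
move=> uv vw e e0 N; have e20 : 0 < e / 2 by rewrite divr_gt0.
have [k Nk wk] := vw _ e20 N.
have [d d0 dP] := continuous_mdist (@continuous_iter (k * n)) v e20.
have [l Nl /dP vl] := uv d d0 N; exists (k + l)%N; first by rewrite (leq_trans Nk)// leq_addr.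
rewrite mulnDl iterD.
by have := metric_triangle w (iter (k * n) F v) (iter (k * n) F (iter (l * n) F u)); lra.
Qed.

(* Some residue class of return times modulo [n] recurs, say that of [i]; then
   so do those of [2 i], [3 i], ..., [n i]. *)
Lemma Rec_pow x : Rec F x -> Rec (iter n F) x.
Proof.
move=> /RecP xx; have [i xi] : exists i, to (iter i F x) x.
  apply: contrapT => /forallNP nto.
  have /(_ n)[e e0 [N NP]] p : exists2 e : R, 0 < e & exists N, forall i k,
      (i < p)%N -> (N <= k)%N -> e <= mdist x (iter (k * n) F (iter i F x)).
    elim: p => [|p [e e0 [N NP]]]; first by exists 1 => //; exists 0%N.
    have /existsNP[e' /not_implyP[e'0 /existsNP[N' N'P]]] := nto p.
    exists (Num.min e e'); first by rewrite lt_min e0.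
    exists (maxn N N') => i k; rewrite ltnS geq_max leq_eqVlt.
    move=> /orP[/eqP->|ip] /andP[Nk N'k]; rewrite ge_min.
      apply/orP; right; rewrite leNgt; apply/negP => lt.
      by apply: N'P; exists k.
    by rewrite NP.
  have [m] := xx e e0 (N * n)%N; rewrite -(leq_divRL _ _ n0) => Nm.
  by rewrite {1}(divn_eq m n) iterD ltNge NP// ltn_mod.
have {}xi j : to (iter (j.+1 * i) F x) x.
  elim: j => [|j IH]; first by rewrite mul1n.
  apply: to_trans IH; rewrite mulSn addnC iterD.
  exact: to_iter.
apply/RecP => e e0 N; have [k Nk] := xi n.-1 e e0 N.
rewrite prednK// (mulnC n) -iterD -mulnDl => xk.
exists (k + i)%N; first by rewrite (leq_trans Nk)// leq_addr.
by rewrite -iterM.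
Qed.

End Pow.
End ContinuousRecurrence.

(** * The hyperspace of subcontinua *)

Section Hyperspace.
Context {R : realType} {T : metricType R}.
Implicit Types (A B : hyperspace T) (x y : T).

Let point_dist_le x (A : set T) a : A a -> point_dist x A <= mdist x a.
Proof.
move=> Aa; apply: ge_inf; last by exists a.
by exists 0 => _ [b _ <-]; exact: mdist_ge0.
Qed.

Let excess_lt (A B : set T) (e : R) a : subcontinuum A -> B !=set0 ->
  excess A B < e -> A a -> exists2 b, B b & mdist a b < e.
Proof.
move=> [A0 cA _] [b0 Bb0] ABe Aa.
have [m Am mP] := compact_EVT_max A0 cA
  (continuous_subspaceT (mdist_continuous (x := b0))).
have : point_dist a B < e.
  apply: le_lt_trans ABe; apply: ub_le_sup; last by exists a.
  exists (mdist b0 m) => _ [c Ac <-]; apply: le_trans (point_dist_le c Bb0) _.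
  by rewrite metric_sym; apply: mP; rewrite inE.
have dB0 : [set mdist a b | b in B] !=set0 by exists (mdist a b0), b0.
by move=> /(inf_lt dB0)[_ [b Bb <-] abe]; exists b.
Qed.

Lemma hyperspace_lt A B (e : R) : mdist A B < e ->
  (forall a, sval A a -> exists2 b, sval B b & mdist a b < e) /\
  (forall b, sval B b -> exists2 a, sval A a & mdist b a < e).
Proof.
rewrite hyperspace_mdistE /hausdorff_dist gt_max => /andP[AB BA].
have [A0 _ _] := svalP A; have [B0 _ _] := svalP B.
by split=> c; apply: excess_lt => //; exact: svalP.
Qed.

Let excess_le (A B : set T) (e : R) : A !=set0 ->
  (forall a, A a -> exists2 b, B b & mdist a b <= e) -> excess A B <= e.
Proof.
move=> [a0 Aa0] AB; apply: ge_sup; first by exists (point_dist a0 B), a0.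
by move=> _ [a /AB[b Bb abe] <-]; exact: le_trans (point_dist_le a Bb) abe.
Qed.

Lemma hyperspace_le A B (e : R) :
  (forall a, sval A a -> exists2 b, sval B b & mdist a b <= e) ->
  (forall b, sval B b -> exists2 a, sval A a & mdist b a <= e) ->
  mdist A B <= e.
Proof.
move=> AB BA; rewrite hyperspace_mdistE /hausdorff_dist ge_max.
have [A0 _ _] := svalP A; have [B0 _ _] := svalP B.
by rewrite !excess_le.
Qed.

Lemma hyperspace_eq A B : sval A = sval B -> A = B.
Proof. by case: A B => [A sA] [B sB] /= AB; exact: eq_exist. Qed.

Lemma hyperspace_closed A : closed (sval A).
Proof. by have [_ + _] := svalP A; exact: (compact_closed (@metric_hausdorff _ T)). Qed.

Lemma hyperspace_meet A (Q : set T) : closed Q ->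
  (forall e : R, 0 < e -> exists2 B, mdist A B < e & sval B `&` Q !=set0) ->
  sval A `&` Q !=set0.
Proof.
move=> cQ AQ; have [_ cA _] := svalP A; apply/set0P/negP => /eqP A0.
have [e e0 eAQ] := compact_mdist_lt cA cQ A0.
have [B /hyperspace_lt[_ BA] [q [Bq Qq]]] := AQ e e0.
by have [a Aa] := BA q Bq; rewrite ltNge metric_sym eAQ.
Qed.

Lemma hyperspace_sub A (W : set T) : closed W ->
  (forall e : R, 0 < e -> exists2 B, mdist A B < e & sval B `<=` W) ->
  sval A `<=` W.
Proof.
move=> cW AW a Aa; apply: cW => U /nbhs_mdist[e e0 eU].
have [B /hyperspace_lt[AB _] BW] := AW e e0.
by have [b Bb ab] := AB a Aa; exists b; split; [exact: BW|exact: eU].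
Qed.

Section Induced.
Context (f : T -> T) (cf : continuous f).

Lemma iter_induced_map n :
  iter n (induced_map cf) = induced_map (continuous_iter cf (n := n)).
Proof.
apply/funext => A; apply: hyperspace_eq.
elim: n => [|n IH] /=; first by rewrite image_id.
by rewrite IH /= image_comp.
Qed.

Lemma sval_iter_induced n A : sval (iter n (induced_map cf) A) = iter n f @` sval A.
Proof. by rewrite iter_induced_map. Qed.

Lemma induced_map_continuous : continuous (induced_map cf).
Proof.
move=> A U /nbhs_mdist[e e0 eU]; have [_ cA _] := svalP A.
have e20 : 0 < e / 2 by rewrite divr_gt0.
have [d d0 dP] := compact_unif_continuous cf cA e20.
apply/nbhs_mdist; exists d => // B /hyperspace_lt[AB BA]; apply: eU.
apply: (@le_lt_trans _ _ (e / 2)); last by lra.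
apply: hyperspace_le => _ /= [c cin <-].
  by have [b Bb cb] := AB c cin; exists (f b); [exists b|exact/ltW/dP].
have [a Aa ca] := BA c cin; exists (f a); first by exists a.
by rewrite metric_sym; apply/ltW/dP => //; rewrite metric_sym.
Qed.

(** Meeting a closed set is a closed condition on continua, so it passes from the late iterates,
    which return near [A], to [A] itself. *)
Lemma Rec_meet A (Q : set T) n : Rec (induced_map cf) A -> closed Q ->
  (forall j, (n <= j)%N -> (iter j f @` sval A) `&` Q !=set0) ->
  sval A `&` Q !=set0.
Proof.
move=> /RecP rA cQ AQ; apply: hyperspace_meet => // e e0.
have [m nm Am] := rA e e0 n; exists (iter m (induced_map cf) A) => //.
by rewrite sval_iter_induced; exact: AQ.
Qed.

Lemma Rec_sub A (W : set T) n : Rec (induced_map cf) A -> closed W ->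
  (forall j, (n <= j)%N -> iter j f @` sval A `<=` W) -> sval A `<=` W.
Proof.
move=> /RecP rA cW AW; apply: hyperspace_sub => // e e0.
have [m nm Am] := rA e e0 n; exists (iter m (induced_map cf) A) => //.
by rewrite sval_iter_induced; exact: AW.
Qed.

Lemma singleton_mdist x y : mdist (singleton x) (singleton y) = mdist x y.
Proof.
apply/eqP; rewrite eq_le hyperspace_le /=.
- rewrite leNgt; apply/negP => /hyperspace_lt[/(_ x erefl)[_ ->]].
  by rewrite ltxx.
- by move=> _ ->; exists y.
- by move=> _ ->; exists x => //; rewrite metric_sym.
Qed.

Lemma iter_singleton n x : iter n (induced_map cf) (singleton x) = singleton (iter n f x).
Proof. by apply: hyperspace_eq; rewrite sval_iter_induced /= image_set1. Qed.

Lemma Rec_singleton x : Rec (induced_map cf) (singleton x) <-> Rec f x.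
Proof.
split=> /RecP rx; apply/RecP => e e0 n.
  have [m nm] := rx e e0 n; rewrite iter_singleton singleton_mdist.
  by exists m.
by have [m nm] := rx e e0 n; exists m => //; rewrite iter_singleton singleton_mdist.
Qed.

Lemma birkhoff_center_singleton x : birkhoff_center f x ->
  birkhoff_center (induced_map cf) (singleton x).
Proof.
move=> /closure_mdist fx; apply/closure_mdist => e e0.
have [y ry xy] := fx e e0.
by exists (singleton y); [exact/Rec_singleton|rewrite singleton_mdist].
Qed.

End Induced.

Lemma degenerateP A : ~ nondegenerate (sval A) -> exists x, A = singleton x.
Proof.
by move=> /existsNP[x /contrapT Ax]; exists x; exact: hyperspace_eq.
Qed.

End Hyperspace.

(** * Fixed points in recurrent continua *)

Section TreeDynamics.
Context {R : realType} {T : metricType R} (D : T -> T -> R) (E : seq T)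
  (hD : tree_metric [set: T] D E) (cT : compact [set: T]).
Implicit Types (x y z b c u v w p q : T) (A B L : hyperspace T) (g : T -> T).

Let Dxx x : D x x = 0. Proof. exact: tm_refl hD x. Qed.
Let Dge0 x y : 0 <= D x y. Proof. exact: (tm_ge0 hD). Qed.
Let Dtri y x z : D x z <= D x y + D y z. Proof. exact: (tm_tri hD). Qed.
Let DC x y : D x y = D y x. Proof. exact: (tm_sym hD). Qed.
Let D_eq0 x y : D x y = 0 -> x = y. Proof. exact: (tm_sep hD). Qed.
Let Dgt0 x y : x <> y -> 0 < D x y.
Proof.
by move=> xy; rewrite lt_neqAle Dge0 andbT eq_sym; apply/eqP => /D_eq0.
Qed.

Lemma seg_trans_right b u y a : seg D b u y -> seg D y u a ->
  seg D b u a /\ seg D b a y.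
Proof.
rewrite /seg /= => h1 h2; have := Dtri y b a; have := Dtri a b u.
by split; lra.
Qed.

Lemma subcontinuum_seg A x y : sval A x -> sval A y -> seg D x y `<=` sval A.
Proof. by have [_ _ cA] := svalP A; exact: (connected_seg_sub hD cA). Qed.

(** The point is the midpoint of a segment in [A]: moving both ends by less than a quarter of the
    length keeps it between them. Continua close to [A] thus share a point, which turns closeness
    into intersection. *)
Lemma nondegenerate_stable_point A : nondegenerate (sval A) ->
  exists q, sval A q /\ exists2 e : R, 0 < e &
    forall B, mdist A B < e -> sval B q /\ nondegenerate (sval B).
Proof.
move=> nA; have [[x Ax] _ _] := svalP A.
have [y Ay xy] : exists2 y, sval A y & x <> y.
  apply: contrapT => H; apply: (nA x); apply/seteqP; split=> [y Ay|_ ->//].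
  by apply: contrapT => yx; apply: H; exists y => // xy; apply: yx.
have L0 := Dgt0 xy.
have [|q xyq xq] := seg_geo hD (x := x) (y := y) (t := D x y / 2); first lra.
have qy : D q y = D x y / 2 by move: xyq; rewrite /seg /= xq; lra.
have L40 : 0 < D x y / 4 by rewrite divr_gt0.
have /nbhs_mdist[e1 e10 h1] := near_D hD x L40.
have /nbhs_mdist[e2 e20 h2] := near_D hD y L40.
exists q; split; first exact: subcontinuum_seg xyq.
exists (Num.min e1 e2); first by rewrite lt_min e10.
move=> B /hyperspace_lt[AB _].
have [x' Bx'] := AB x Ax; rewrite lt_min => /andP[/h1 xx' _].
have [y' By'] := AB y Ay; rewrite lt_min => /andP[_ /h2 yy'].
split.
  apply: (subcontinuum_seg Bx' By'); rewrite (segC hD).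
  apply: (@seg_stable _ _ _ _ hD _ x).
    rewrite (segC hD); apply: (seg_stable hD xyq).
    by have := Dtri y' q y; rewrite (DC y' y) (DC y' q); lra.
  by have := Dtri x' x q; rewrite xq; lra.
move=> z Bz; move: Bx' By'; rewrite Bz /= => x'z y'z.
have := Dtri z x y; rewrite x'z y'z in xx' yy'; rewrite (DC z y); lra.
Qed.

Section FixedPoint.
Context (g : T -> T) (cg : continuous g).

Let near_g x (e : R) : 0 < e ->
  exists2 d : R, 0 < d & forall y, D x y < d -> D (g x) (g y) < e.
Proof.
move=> e0; apply: (D_nbhs hD cT).
exact: (cg (near_D hD (g x) e0)).
Qed.

(** The points which [g] fixes or pushes away from [b]; stated as betweenness, this is a closed
    condition. *)
Let fwd b := [set y | seg D b (g y) y].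

Let closed_fwd b : closed (fwd b).
Proof.
move=> y cy; apply: contrapT => ny.
have gap : 0 < D b y + D y (g y) - D b (g y).
  rewrite lt_neqAle subr_ge0 Dtri andbT; apply/eqP => h.
  by apply: ny; rewrite /fwd /seg /=; lra.
set s := _ - _ in gap; have s0 : 0 < s / 6 by rewrite divr_gt0.
have [d d0 dP] := near_g y s0.
have m0 : 0 < Num.min d (s / 6) by rewrite lt_min d0.
have [y' []] := cy _ (near_D hD y m0).
rewrite /fwd /seg /= lt_min => hy' /andP[/dP gy yy'].
have := Dtri y' b y; have := Dtri y' y (g y); have := Dtri (g y') y' (g y).
have := Dtri (g y) b (g y'); rewrite (DC y' y) (DC (g y') (g y)).
by rewrite /s in yy' gy s0 *; lra.
Qed.

Let fwd_seg b := [set x | seg D b x `<=` fwd b].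

Let closed_fwd_seg b : closed (fwd_seg b).
Proof.
move=> x cx y bxy; have [->|/eqP xy] := eqVneq y x.
  apply: closed_fwd => U /cx[x' [Wx' Ux']]; exists x'; split => //.
  exact: (Wx' _ (seg_right hD _ _)).
have e0 : 0 < D x y / 2 by rewrite divr_gt0// Dgt0// => /esym.
have [x' [Wx' /= xx']] := cx _ (near_D hD x e0).
apply: Wx'; apply: (seg_stable hD bxy).
by have := Dtri x' x y; lra.
Qed.

(* A farthest point [z] of [fwd_seg b] is fixed, since otherwise the points
   slightly beyond [z] towards [g z] would be in [fwd_seg b] as well. *)
Let fixed_end b : exists2 z, g z = z & fwd_seg b z.
Proof.
have W0 : fwd_seg b !=set0.
  exists b => y bby; have -> : y = b by exact: (seg_refl hD bby).
  exact: (seg_left hD).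
have [z + zmax] := compact_EVT_max W0 (closed_compact cT (closed_fwd_seg (b := b)))
  (continuous_subspaceT (D_continuous hD (x := b))).
rewrite inE => Wz; exists z => //; apply: contrapT => gz.
have d0 : 0 < D z (g z) by apply: Dgt0 => /esym.
have d40 : 0 < D z (g z) / 4 by rewrite divr_gt0.
have [n n0 nP] := near_g z d40.
pose s := Num.min (n / 2) (D z (g z) / 2).
have s0 : 0 < s by rewrite lt_min !divr_gt0.
have sn : s <= n / 2 by rewrite ge_min lexx.
have sd : s <= D z (g z) / 2 by rewrite ge_min lexx orbT.
have [|x zgx zx] := seg_geo hD (x := z) (y := g z) (t := s); first lra.
have bgz : seg D b (g z) z by apply: Wz; exact: (seg_right hD).
have [_ bxz] := seg_trans_right bgz zgx.
suff Wx : fwd_seg b x.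
  have := zmax x; rewrite inE => /(_ Wx).
  by move: bxz; rewrite /seg /= zx; lra.
move=> y bxy; have [/Wz //|zxy] := seg_split hD z bxy.
have [zgy _] := seg_trans hD zgx zxy.
have [bgy _] := seg_trans_right bgz zgy.
apply: (seg_stable hD bgy).
have zy : D z y <= s by move: zxy; rewrite /seg /= zx; have := Dge0 y x; lra.
have /nP : D z y < n by lra.
move: zgy; rewrite /seg /=; have := Dtri (g y) y (g z).
by rewrite (DC y (g y)) (DC (g y) (g z)); lra.
Qed.

(** A point slightly beyond [a] towards [z] is pushed away from [b], and its image is close to
    [g a]; hence [g a] lies beyond that point too, on the same side of [a] as [z]. *)
Let advance b z a : fwd_seg b z -> seg D b z a -> a <> z -> g a <> a ->
  exists c, [/\ seg D b z c, D b a < D b c & seg D a (g a) c].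
Proof.
move=> Wz bza az ga.
have d0 : 0 < D a (g a) by apply: Dgt0 => /esym.
have d40 : 0 < D a (g a) / 4 by rewrite divr_gt0.
have [n n0 nP] := near_g a d40.
(* The three bounds keep [g y] within a quarter of [D a (g a)] from [g a], keep [y] at least half of
   it away from [g a], and keep [y] on the segment from [a] to [z]. *)
pose s := Num.min (Num.min (n / 2) (D a (g a) / 2)) (D a z).
have s0 : 0 < s by rewrite !lt_min !divr_gt0//= Dgt0.
have sn : s <= n / 2 by rewrite !ge_min lexx.
have sd : s <= D a (g a) / 2 by rewrite !ge_min lexx orbT.
have sz : s <= D a z by rewrite ge_min lexx orbT.
have [|y azy ay] := seg_geo hD (x := a) (y := z) (t := s); first lra.
have [bzy bya] := seg_trans_right bza azy.
have bgy : seg D b (g a) y.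
  apply: (@seg_stable _ _ _ _ hD _ (g y)); first exact: Wz.
  have /nP : D a y < n by lra.
  have := Dtri y a (g a); rewrite (DC (g y)) (DC y (g a)); lra.
exists y; split => //; last by have [] := seg_trans hD bgy bya.
by move: bya; rewrite /seg /= ay; lra.
Qed.

Lemma Rec_fixed_point A : Rec (induced_map cg) A ->
  sval A `&` g @` sval A !=set0 -> exists2 p, sval A p & g p = p.
Proof.
move=> rA [w [Aw [v Av gvw]]]; apply: contrapT => noF.
pose Aj j := iter j g @` sval A.
have sAj j : sval (induced_map (continuous_iter cg (n := j)) A) = Aj j by [].
have AjS j x : Aj j x -> Aj j.+1 (g x) by move=> [a Aa <-]; exists a.
(* A fixed point in one iterate stays in all later ones, hence belongs to [A] by recurrence. *)
have noFj j p : Aj j p -> g p <> p.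
  move=> Ajp gp; apply: noF; suff Ap : sval A p by exists p.
  have cp : closed [set p].
    by apply: compact_closed; [exact: metric_hausdorff|exact: compact_set1].
  have [|x [Ax xp]] := @Rec_meet _ _ g cg A [set p] j rA cp; last by rewrite -xp.
  move=> k /subnK <-; exists p; split => //.
  by elim: (k - j)%N => [//|m /AjS]; rewrite gp.
have [[b Ab] _ _] := svalP A; have [z gz Wz] := fixed_end b.
have last j c : Aj j c -> seg D b z c -> exists a, [/\ Aj j a, seg D b z a &
    forall y, Aj j y -> seg D b z y -> D b y <= D b a].
  move=> jc bzc; have K0 : Aj j `&` seg D b z !=set0 by exists c.
  have cK : compact (Aj j `&` seg D b z).
    apply: (closed_compact cT); apply: closedI; last exact: closed_seg hD _ _.
    by rewrite -sAj; exact: hyperspace_closed.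
  have [a + amax] := compact_EVT_max K0 cK
    (continuous_subspaceT (D_continuous hD (x := b))).
  rewrite inE => -[ja bza]; exists a; split => // y jy bzy.
  by apply: amax; rewrite inE.
(* Consecutive iterates share a point; [seg_split] there puts the point [c] just beyond [a] into one
   of them, and it is not the first, as [a] is the last point of that one. *)
have step j a : Aj j a -> seg D b z a ->
    (forall y, Aj j y -> seg D b z y -> D b y <= D b a) ->
    exists c, [/\ Aj j.+1 c, seg D b z c & D b a < D b c].
  move=> ja bza alast.
  have az : a <> z by move=> az; apply: (noFj j a ja); rewrite az.
  have [c [bzc ac aac]] := advance Wz bza az (noFj _ _ ja).
  exists c; split => //.
  have nc : ~ Aj j c by move=> /alast/(_ bzc); lra.
  have jw : Aj j (iter j g w) by exists w.
  have j1w : Aj j.+1 (iter j g w) by exists v => //; rewrite iterSr gvw.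
  have [awc|] := seg_split hD (iter j g w) aac.
    case: nc; rewrite -sAj in ja jw *; exact: subcontinuum_seg ja jw _ awc.
  move: (AjS _ _ ja); rewrite -sAj in j1w *.
  by move=> j1a; exact: subcontinuum_seg j1w j1a _.
have [a0 [A0a bza0 last0]] := last 0%N b (ex_intro2 _ _ b Ab erefl) (seg_left hD b z).
have [c1 [A1c bzc1 ac1]] := step _ _ A0a bza0 last0.
(* The part of the path from [c1] on: every later iterate reaches it, but [A] stops at [a0], before
   [c1]. *)
pose Q := seg D b z `&` [set y | D b c1 <= D b y].
have cQ : closed Q.
  apply: closedI; first exact: (closed_seg hD).
  have -> : [set y | D b c1 <= D b y] =
    (D b : T -> R^o) @^-1` [set t | D b c1 <= t] by [].
  apply: preimage_closed; last exact: closed_ge.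
  by move=> y _; exact: (D_continuous hD).
have [j j1|y [Ay [bzy /= c1y]]] := @Rec_meet _ _ g cg A Q 1 rA cQ.
  case: j j1 => // j _; elim: j => [|j [c [jc [bzc c1c]]]].
    by exists c1; split => //; split => //=.
  have [a [ja bza alast]] := last _ _ jc bzc.
  have [c' [jc' bzc' ac']] := step _ _ ja bza alast.
  exists c'; split => //; split => //=.
  by have := alast c jc bzc; rewrite /= in c1c; lra.
by have := last0 y (ex_intro2 _ _ y Ay erefl) bzy; lra.
Qed.

End FixedPoint.
End TreeDynamics.

(** * Periods of recurrent continua *)

Lemma count_pigeonhole (I : finType) (A : {set I}) (S : eqType) (s : seq S)
    (col : S -> I) m : (forall x, x \in s -> col x \in A) ->
  (#|A| * m < size s)%N -> exists2 i, i \in A & (m < count (fun x => col x == i) s)%N.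
Proof.
move=> sA ms; apply: contrapT => H.
have : (size s <= \sum_(i in A) count (fun x => col x == i) s)%N.
  elim: s sA {ms H} => [//|x s IH] sA /=.
  rewrite big_split /= (bigD1 (col x)) ?sA ?mem_head//= eqxx.
  rewrite -addnA add1n ltnS (leq_trans (IH _)) ?leq_addl// => y ys.
  by apply: sA; rewrite inE ys orbT.
apply/negP; rewrite -ltnNge; apply: leq_ltn_trans ms.
rewrite -sum_nat_const; apply: leq_sum => i iA.
by rewrite leqNgt; apply/negP => mi; apply: H; exists i.
Qed.

(** The colours will be maps, with [col a c] the composite of [col a b] and [col b c]; equality of
    all three makes the common map idempotent. *)
Lemma ramsey_triangle (I : finType) : exists m, forall col : nat -> nat -> I,
  exists a b c, [/\ (a < b < c)%N, (c < m)%N, col a b = col b c & col a b = col a c].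
Proof.
suff /(_ #|I|)[m mP] r : exists m, forall (A : {set I}) (s : seq nat) (col : nat -> nat -> I),
    (#|A| <= r)%N -> sorted ltn s -> (m <= size s)%N ->
    (forall a b, a \in s -> b \in s -> (a < b)%N -> col a b \in A) ->
    exists a b c, [/\ a \in s, b \in s, c \in s, (a < b < c)%N &
      col a b = col b c /\ col a b = col a c].
  exists m => col; have [||||a [b [c [_ _ + abc [h1 h2]]]]] := mP [set: I]%SET (iota 0 m) col.
  - by rewrite cardsT.
  - exact: iota_ltn_sorted.
  - by rewrite size_iota.
  - by move=> *; rewrite inE.
  by rewrite mem_iota => /andP[_ cm]; exists a, b, c.
elim: r => [|r [m mP]].
  exists 2%N => A [//|a [//|b s]] col; rewrite leqn0 cards_eq0 => /eqP -> /= /andP[ab _] _.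
  by move=> /(_ a b); rewrite !inE !eqxx orbT /= => /(_ isT isT ab).
(* One more for the vertex [a], whose edges to the others are sorted by colour, and one for the
   strict inequality in the pigeonhole principle. *)
exists (r.+1 * m).+2 => A [//|a s] col Ar /[dup] sas /=.
move=> /(order_path_min ltn_trans)/allP sa ms colA.
have sorted_s : sorted ltn s := path_sorted sas.
have [||i iA mi] := @count_pigeonhole _ A _ s (col a) m.
- by move=> b bs; apply: colA; rewrite ?inE ?eqxx ?bs ?orbT//; exact: sa.
- by rewrite (@leq_ltn_trans (r.+1 * m))// leq_mul2r Ar orbT.
pose t := [seq x <- s | col a x == i].
have ts b : b \in t -> b \in s /\ col a b = i.
  by rewrite mem_filter => /andP[/eqP -> ->].
have [[b [c [/ts[bs ab] /ts[cs ac] bc bci]]]|nbc] :=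
    pselect (exists b c, [/\ b \in t, c \in t, (b < c)%N & col b c = i]).
  exists a, b, c; rewrite !inE eqxx bs cs !orbT bc ab ac bci; split => //.
  by rewrite andbT; exact: sa.
have [||||b [c [d [/ts[bs _] /ts[cs _] /ts[ds _] bcd h]]]] := mP (A :\ i)%SET t col.
- by move: Ar; rewrite (cardsD1 i) iA.
- by apply: sorted_filter sorted_s; exact: ltn_trans.
- by rewrite size_filter ltnW.
- move=> b c bt ct bc; rewrite !inE; apply/andP; split.
    by apply/eqP => bci; apply: nbc; exists b, c.
  have [bs _] := ts _ bt; have [cs _] := ts _ ct.
  by apply: colA; rewrite // inE ?bs ?cs orbT.
by exists b, c, d; rewrite !inE bs cs ds !orbT.
Qed.

Section PeriodBound.
Context {R : realType} {T : metricType R} (D : T -> T -> R) (E : seq T)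
  (hD : tree_metric [set: T] D E) (cT : compact [set: T]).
Implicit Types (A B : hyperspace T) (g : T -> T).

(** * Arms of the iterates at a fixed point *)

Section Arms.
Context (g : T -> T) (cg : continuous g) (p : T) (gp : g p = p)
  (A : hyperspace T) (Ap : sval A p) (rA : Rec (induced_map cg) A).

Local Notation N := (size E).
Let En (k : 'I_N) := tnth (in_tuple E) k.
Let F := induced_map cg.
Let An n := iter n F A.
Let C k n := sval (An n) `&` seg D p (En k).

Let AnS n : sval (An n.+1) = g @` sval (An n). Proof. by []. Qed.

Let Anp n : sval (An n) p.
Proof. by elim: n => [//|n IH]; exists p. Qed.

Let armP k n : exists2 e, sval (An n) e & C k n = seg D p e.
Proof.
have C0 : C k n !=set0 by exists p; split => //; exact: (seg_left hD).
have cC : compact (C k n).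
  apply: (closed_compact cT); apply: closedI; last exact: (closed_seg hD).
  exact: hyperspace_closed.
have [e + emax] := compact_EVT_max C0 cC
    (continuous_subspaceT (D_continuous hD (x := p))).
rewrite inE => -[Ae pEe]; exists e => //; apply/seteqP; split=> y.
  move=> [Ay pEy]; apply: (seg_le hD pEy pEe).
  by apply: emax; rewrite inE.
move=> pey; split; first exact: (subcontinuum_seg hD (Anp n) Ae).
by have [] := seg_trans hD pEe pey.
Qed.

Let arm_total k n m : C k n `<=` C k m \/ C k m `<=` C k n.
Proof.
have [e Ae Ce] := armP k n; have [e' Ae' Ce'] := armP k m.
have pEe : seg D p (En k) e by have [] : C k n e by rewrite Ce; exact: (seg_right hD).
have pEe' : seg D p (En k) e' by have [] : C k m e' by rewrite Ce'; exact: (seg_right hD).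
rewrite Ce Ce'; have /orP[ee'|e'e] := le_total (D p e) (D p e'); [left|right] => y py.
  by have [] := seg_trans hD (seg_le hD pEe pEe' ee') py.
by have [] := seg_trans hD (seg_le hD pEe' pEe e'e) py.
Qed.

Let arm_cover n y : sval (An n) y -> exists k, C k n y.
Proof.
move=> Ay; have [e eE pe] := tm_ends hD (b := p) (x := y) I I.
have /tnthP[k ek] : e \in in_tuple E by [].
by exists k; split => //; rewrite /En -ek.
Qed.

Let arm_step nk : exists j, C nk.2 nk.1.+1 `<=` g @` C j nk.1.
Proof.
case: nk => n k /=; have [e + Ce] := armP k n.+1; rewrite AnS => -[v Av gv].
have [j Cjv] := arm_cover Av; exists j; rewrite Ce.
have [e' _ Cj] := armP j n.
apply: (connected_seg_sub hD).
- apply: connected_continuous_connected; last exact: continuous_subspaceT.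
  by rewrite Cj; exact: (connected_seg hD cT).
- by exists p => //; split => //; exact: (seg_left hD).
- by exists v.
Qed.

Let sigma := projT1 (choice arm_step).
Let sigmaP n k : C k n.+1 `<=` g @` C (sigma (n, k)) n.
Proof. exact: (projT2 (choice arm_step) (n, k)). Qed.

(** Traces the choices [sigma] backwards: the arm at time [a] whose image after [d] steps covers the
    arm [k] at time [a + d]. *)
Let Fixpoint hist d a (k : 'I_N) : 'I_N :=
  if d is d'.+1 then hist d' a (sigma ((a + d')%N, k)) else k.

Let hist_sub d a k : C k (a + d)%N `<=` iter d g @` C (hist d a k) a.
Proof.
elim: d k => [|d IH] k; first by rewrite addn0 image_id.
rewrite addnS; apply: subset_trans (@sigmaP _ _) _.
by move=> _ [y /IH[z Cz <-] <-]; exists z.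
Qed.

Let histD d d' a k : hist (d + d')%N a k = hist d a (hist d' (a + d)%N k).
Proof.
elim: d' k => [|d' IH] k; first by rewrite addn0.
by rewrite addnS /= IH addnA.
Qed.

(* Each arm of [g^n(A)] at the fixed point [p] is covered by the image of an
   arm of [g^(n-1)(A)]. By Ramsey, there are times [a < b < c] between which
   the composite choices of arms are the same idempotent map; on its image the
   arms do not grow, hence [g^c(A)] is contained in [g^(a+c-b)(A)]. *)
Lemma period_bounded m : (forall col : nat -> nat -> {ffun 'I_N -> 'I_N},
    exists a b c, [/\ (a < b < c)%N, (c < m)%N, col a b = col b c &
      col a b = col a c]) ->
  exists2 d, (0 < d <= m)%N & iter d F A = A.
Proof.
move=> /(_ (fun a b => [ffun k => hist (b - a) a k]))[a [b [c]]].
move=> [/andP[ab bc] cm /ffunP ab_bc /ffunP ab_ac].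
pose d := (b - a)%N; pose d' := (c - b)%N.
have bE : b = (a + d)%N by rewrite /d; lia.
have cE : c = (a + (d + d'))%N by rewrite /d /d'; lia.
have d0 : (0 < d)%N by rewrite /d; lia.
have dm : (d <= m)%N by rewrite /d; lia.
exists d; first by rewrite d0.
have H1 k : hist d a k = hist d' b k by have := ab_bc k; rewrite !ffunE.
have H2 k : hist d a (hist d a k) = hist d a k.
  have := ab_ac k; rewrite !ffunE -/d {2}H1 => ->.
  by rewrite (_ : (c - a = d + d')%N) ?histD -?bE//; rewrite /d /d'; lia.
pose h := iter d g.
have ch : continuous h by exact: continuous_iter.
have hE : iter d F = induced_map ch.
  by rewrite /F iter_induced_map; congr induced_map; exact: Prop_irrelevance.
have rh n : Rec (induced_map ch) (An n).
  rewrite -hE; apply: Rec_pow => //; first exact: induced_map_continuous.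
  by apply: Rec_iter => //; exact: induced_map_continuous.
(* Otherwise the arm at time [a] lies in the arm at time [b], which its image under [h] covers. All
   iterates of [h] then spread the former over the latter, and recurrence puts the latter into
   [An a]. *)
have shrink k : C (hist d a k) b `<=` C (hist d a k) a.
  set i := hist d a k; have [//|Cab] := arm_total i b a.
  have Ch : C i b `<=` h @` C i a.
    by have := @hist_sub d a i; rewrite -bE /i H2.
  have Chj j : C i b `<=` iter j.+1 h @` C i a.
    elim: j => [//|j IH] x /Ch[y /Cab/IH[z Cz <-] <-]; by exists z.
  move=> x Cx; split; last by case: Cx.
  have cx : closed [set x].
    by apply: compact_closed; [exact: metric_hausdorff|exact: compact_set1].
  have [|y [Ay <-//]] := @Rec_meet _ _ h ch (An a) [set x] 1 (rh a) cx.
  move=> [//|j] _; have [z [Az _] zx] := Chj j x Cx.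
  by exists x; split => //; exists z.
pose n0 := (a + d')%N.
(* An arm at time [c] is covered, through [d'] steps, by an arm at time [b] in the image of
   [hist d a]; by [shrink] it is contained in the same arm at time [a], from which [d'] steps lead
   into [An n0]. *)
have sub0 : sval (iter d F (An n0)) `<=` sval (An n0).
  rewrite -iterD (_ : (d + n0 = c)%N); last by rewrite cE /n0; lia.
  move=> x /arm_cover[k].
  rewrite (_ : c = b + d')%N; last by rewrite cE bE; lia.
  move=> /hist_sub[y]; rewrite -H1 => /shrink[Ay _] <-.
  by rewrite /n0 addnC /An iterD sval_iter_induced; exists y.
have subj j : sval (iter (j.+1 * d) F (An n0)) `<=` sval (iter d F (An n0)).
  elim: j => [|j IH]; first by rewrite mul1n.
  rewrite mulSn iterD sval_iter_induced [sval (iter d F _)]sval_iter_induced.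
  by move=> _ [y /IH/sub0 Ay <-]; exists y.
have fix0 : iter d F (An n0) = An n0.
  apply: hyperspace_eq; apply/seteqP; split => //.
  apply: (@Rec_sub _ _ h ch (An n0) _ 1 (rh n0)); first exact: hyperspace_closed.
  move=> [//|j] _ _ [y Ay <-]; apply: (subj j); rewrite sval_iter_induced.
  by exists y => //; rewrite iterM.
(* All iterates from [n0] on are fixed by [iter d F], and some of them come arbitrarily close to
   [A]. *)
apply: fixed_by_approximation => [|e e0].
  by apply: continuous_iter; exact: induced_map_continuous.
have /RecP/(_ e e0 n0)[n nn0 An_e] := rA; exists (iter n F A) => //.
have -> : iter n F A = iter (n - n0) F (An n0) by rewrite -iterD subnK.
by rewrite -iterD addnC iterD fix0.
Qed.

End Arms.

(** The factorial is a common multiple of all periods up to the Ramsey bound. *)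
Lemma uniform_period : exists2 M, (0 < M)%N &
  forall (g : T -> T) (cg : continuous g) p A, g p = p -> sval A p ->
  Rec (induced_map cg) A -> iter M (induced_map cg) A = A.
Proof.
have [m mP] := ramsey_triangle {ffun 'I_(size E) -> 'I_(size E)}.
exists m`! => [|g cg p A gp Ap rA]; first exact: fact_gt0.
have [d dm dA] := period_bounded gp Ap rA mP.
have /dvdnP[k ->] : (d %| m`!)%N by apply: dvdn_fact.
by elim: k => [//|k IH]; rewrite mulSn iterD IH.
Qed.

End PeriodBound.

(** * Cycles of trees and the Birkhoff center *)

Lemma chain_subcontinuum {X : topologicalType} (S : nat -> set X) n :
  (forall j, subcontinuum (S j)) -> (forall j, S j `&` S j.+1 !=set0) ->
  subcontinuum (\bigcup_(j in `I_n.+1) S j).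
Proof.
move=> sS cS; elim: n => [|n [[x Ux] cU kU]].
  rewrite (_ : \bigcup_(_ in _) _ = S 0%N); first exact: sS.
  by apply/seteqP; split=> [x [[|//] _]//|x Sx]; exists 0%N.
rewrite (_ : \bigcup_(_ in _) _ = (\bigcup_(j in `I_n.+1) S j) `|` S n.+1).
  have [_ cSn kSn] := sS n.+1; split; first by exists x; left.
  - exact: compactU.
  - apply: connectedU => //; have [y [Sy Sy']] := cS n.
    by exists y; split => //; exists n => /=.
apply/seteqP; split=> y.
  move=> [j /=]; rewrite ltnS leq_eqVlt => /orP[/eqP ->|jn] Sy; first by right.
  by left; exists j.
by move=> [[j /= jn Sy]|Sy]; [exists j => //=; exact: ltnW|exists n.+1 => /=].
Qed.

Lemma connected_in_block {X : topologicalType} (G : nat -> set X) k i (C : set X) x :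
  (forall j, closed (G j)) -> trivIset `I_k G -> connected C ->
  C `<=` \bigcup_(j in `I_k) G j -> (i < k)%N -> C x -> G i x -> C `<=` G i.
Proof.
move=> cG tG cC CG ik Cx Gx.
suff <- : C `&` G i = C by move=> y [].
apply: cC; first by exists x.
- exists (~` (\bigcup_(j in `I_k `\ i) G j)).
    rewrite openC; apply: closed_bigcup => //.
    by apply: sub_finite_set (finite_II k) => j [].
  apply/seteqP; split=> y [Cy].
    move=> Gy; split => // -[j [/= jk ji] Gjy]; apply: ji.
    by apply: (tG j i) => //; exists y.
  move=> nGy; split => //; have [j jk Gjy] := CG y Cy.
  have [<- //|/eqP ji] := eqVneq j i.
  by exfalso; apply: nGy; exists j.
- by exists (G i).
Qed.

Section Main.
Context {R : realType} {T : metricType R} (D : T -> T -> R) (E : seq T)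
  (hD : tree_metric [set: T] D E) (cT : compact [set: T])
  (f : T -> T) (cf : continuous f).
Implicit Types (A B L U : hyperspace T).

Local Notation F := (induced_map cf).
Local Notation meets A B := (sval A `&` sval B !=set0).

Let iterF n : induced_map (continuous_iter cf (n := n)) = iter n F.
Proof. by rewrite iter_induced_map. Qed.

Let iter_mem n A x : sval A x -> sval (iter n F A) (iter n f x).
Proof. by rewrite sval_iter_induced => Ax; exists x. Qed.

Let iter_sub n A B : sval A `<=` sval B -> sval (iter n F A) `<=` sval (iter n F B).
Proof. by rewrite !sval_iter_induced; exact: image_subset. Qed.

Let iter_mul_fixed j n A : iter n F A = A -> iter (j * n) F A = A.
Proof. by move=> AA; elim: j => [//|j IH]; rewrite mulSn iterD IH. Qed.

Lemma Rec_iter_fixed_point A i : Rec F A -> (0 < i)%N -> meets A (iter i F A) ->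
  exists2 p, sval A p & iter i f p = p.
Proof.
move=> rA i0 AiA; apply: (Rec_fixed_point hD cT (cg := continuous_iter cf (n := i))).
  by rewrite iterF; apply: Rec_pow => //; exact: induced_map_continuous.
by rewrite -sval_iter_induced.
Qed.

Lemma Rec_iter_period : exists2 M, (0 < M)%N & forall A i, Rec F A ->
  (0 < i)%N -> meets A (iter i F A) -> iter (M * i) F A = A.
Proof.
have [M M0 MP] := uniform_period hD cT; exists M => // A i rA i0 AiA.
have [p Ap ip] := Rec_iter_fixed_point rA i0 AiA.
rewrite iterM -iterF; apply: MP ip Ap _.
by rewrite iterF; apply: Rec_pow => //; exact: induced_map_continuous.
Qed.

(** An iterate close enough to [A] contains the stable point of [A], so it meets [A]. *)
Lemma Rec_nondegenerate A : Rec F A -> nondegenerate (sval A) ->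
  Per F A /\ exists2 p, sval A p & Per f p.
Proof.
move=> rA nA; have [q [Aq [e e0 eP]]] := nondegenerate_stable_point hD nA.
have /RecP/(_ e e0 1%N)[i i0 /eP[iq _]] := rA.
have AiA : meets A (iter i F A) by exists q.
have [M M0 MP] := Rec_iter_period; split.
  by exists (M * i)%N; [rewrite muln_gt0 M0|exact: MP].
have [p Ap ip] := Rec_iter_fixed_point rA i0 AiA.
by exists p => //; exists i.
Qed.

(** * Unions along orbits and first returns *)

Lemma periodic_union B i k : (0 < k)%N -> iter (k * i) F B = B ->
  meets B (iter i F B) ->
  exists2 U, sval U = \bigcup_j sval (iter (j * i) F B) & iter i F U = U.
Proof.
case: k => // k _ kB [x [Bx ix]].
pose S j := sval (iter (j * i) F B).
have SE : \bigcup_(j in `I_k.+1) S j = \bigcup_j S j.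
  apply/seteqP; split=> y [j _ Sy]; first by exists j.
  exists (j %% k.+1)%N; first by rewrite /= ltn_mod.
  move: Sy; rewrite /S {1}(divn_eq j k.+1) mulnDl addnC iterD -mulnA.
  by rewrite (iter_mul_fixed _ kB).
have sU : subcontinuum (\bigcup_j S j).
  rewrite -SE; apply: chain_subcontinuum => j; first exact: svalP.
  exists (iter (j * i) f x); split; first exact: iter_mem.
  by rewrite /S mulSn addnC iterD; exact: iter_mem.
exists (exist _ _ sU) => //; apply: hyperspace_eq; rewrite sval_iter_induced /=.
apply/seteqP; split=> [_ [y [j _ Sy] <-]|y [j _ Sy]].
  by exists j.+1 => //; rewrite /S mulSn iterD; exact: iter_mem.
(* By periodicity the piece of index 0 is also that of index [k.+1], so each point has a preimage in
   the union. *)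
have {Sy}[j' Sy] : exists j', S j'.+1 y.
  by case: j Sy => [|j] Sy; [exists k; rewrite /S kB|exists j].
by move: Sy; rewrite /S mulSn iterD sval_iter_induced => -[z Sz <-]; exists z => //; exists j'.
Qed.

Definition first_return m L := iter m F L = L /\
  forall a, (0 < a < m)%N -> ~ meets L (iter a F L).

(** A common point is pushed forward by [a] times [m - 1] steps: the iterate [a] then returns to [L]
    and the iterate [b] to the iterate [b - a]. *)
Lemma first_return_disjoint m L a b : first_return m L -> (a < b)%N ->
  (b - a < m)%N -> ~ meets (iter a F L) (iter b F L).
Proof.
move=> [mL dL] ab bam [y [ay by_]]; case: m mL dL bam => // m mL dL bam.
apply: (dL (b - a)%N); first by rewrite subn_gt0 ab.
exists (iter (a * m) f y); split.
  have := iter_mem (a * m) ay; rewrite -iterD addnC -mulnS.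
  by rewrite iter_mul_fixed.
have := iter_mem (a * m) by_; rewrite -iterD.
have -> : (a * m + b = (b - a) + a * m.+1)%N by rewrite mulnS; lia.
by rewrite iterD iter_mul_fixed.
Qed.

(* If [f^a(L)] met [L] for some [0 < a < m], the union of the [f^(ja)(L)] would
   be a continuum containing a fixed point of [f^a]; such a point returns into
   [L] and then into [B], contradicting the choice of [m]. *)
Lemma first_return_hull B m k : (0 < k)%N -> iter k F B = B -> (0 < m)%N ->
  meets B (iter m F B) -> (forall a, (0 < a < m)%N -> ~ meets B (iter a F B)) ->
  exists2 L, sval B `<=` sval L & first_return m L.
Proof.
move=> k0 kB m0 BmB mmin.
have kmB : iter (k * m) F B = B by rewrite mulnC iter_mul_fixed.
have [L LE mL] := periodic_union k0 kmB BmB.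
exists L; first by rewrite LE => x Bx; exists 0%N.
split => // a /andP[a0 am] LaL.
have maL : iter (m * a) F L = L by rewrite mulnC iter_mul_fixed.
have [U UE aU] := periodic_union m0 maL LaL.
have [||w + aw] := @Rec_iter_fixed_point U a _ a0.
- by apply: Per_Rec; exists a.
- by rewrite aU setIid; have [] := svalP U.
have jaw j : iter (j * a) f w = w.
  by elim: j => [//|j IH]; rewrite mulSn iterD IH.
rewrite UE => -[j _ jw].
have {jw} : sval L w.
  have := iter_mem (j * m.-1 * a) jw; rewrite jaw -iterD -mulnDl -mulnSr prednK//.
  by rewrite -mulnA iter_mul_fixed.
rewrite LE => -[l _ lw].
apply: (mmin a); first by rewrite a0.
pose v := iter (l * k.-1 * m) f w.
have Bv : sval B v.
  have := iter_mem (l * k.-1 * m) lw; rewrite -iterD -mulnDl -mulnSr prednK//.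
  by rewrite -mulnA iter_mul_fixed.
exists v; split => //.
suff -> : v = iter a f v by exact: iter_mem.
by rewrite /v -iterD addnC iterD aw.
Qed.

(* The [size E + 1] disjoint continua [f^(ti)(L)] all meet [B] (in the orbit of
   [q]), and two of them cannot leave [B] in the direction of the same end. *)
Lemma first_return_sub B L m t q : (0 < t)%N -> iter t F B = B ->
  first_return m L -> sval B q -> sval L q -> (t * size E < m)%N ->
  sval L `<=` sval B.
Proof.
move=> t0 tB mL Bq Lq tm; have [mLL _] := mL; have m0 : (0 < m)%N by lia.
(* If one of these iterates lies in [B], then after [i * m] steps of length [t] it has become [L]
   again, still inside [B], which these steps preserve. *)
have [[i tiL]|nsub] := pselect (exists i, sval (iter (i * t) F L) `<=` sval B).
  have := iter_sub (n := i * m.-1 * t) tiL.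
  by rewrite (iter_mul_fixed _ tB) -iterD -mulnDl -mulnSr prednK// mulnAC (iter_mul_fixed _ mLL).
have /choice[y yP] : forall i : 'I_(size E).+1, exists y, sval (iter (i * t) F L) y /\ ~ sval B y.
  move=> i; apply: contrapT => H; apply: nsub; exists i => y Ly.
  by apply: contrapT => nBy; apply: H; exists y.
have /choice[k kP] : forall i, exists k : 'I_(size E), seg D q (tnth (in_tuple E) k) (y i).
  move=> i; have [e eE qe] := tm_ends hD (b := q) (x := y i) I I.
  have /tnthP[k ek] : e \in in_tuple E by [].
  by exists k; rewrite -ek.
have /injectivePn[i [j ij kij]] : ~~ injectiveb k.
  apply/negP => /injectiveP/leq_card; rewrite !card_ord.
  by rewrite ltnn.
wlog yij : i j ij kij / D q (y i) <= D q (y j).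
  have /orP[h H|h H] := le_total (D q (y i)) (D q (y j)); first exact: (H i j).
  by apply: (H j i) => //; rewrite eq_sym.
have [Lyi nByi] := yP i; have [Lyj nByj] := yP j.
have qyj : seg D q (y j) (y i).
  by apply: (seg_le hD (kP i) _ yij); rewrite kij.
(* As [y i] lies between [q] and [y j], apply [seg_split] at the image of [q] in the iterate [j]:
   this image belongs to [B], so [y i] would be in [B] unless it is in that iterate. *)
have LL : meets (iter (i * t) F L) (iter (j * t) F L).
  exists (y i); split => //.
  have [qy|jy] := seg_split hD (iter (j * t) f q) qyj.
    case: nByi; apply: (subcontinuum_seg hD Bq _ qy).
    by have := iter_mem (j * t) Bq; rewrite (iter_mul_fixed _ tB).
  exact: (subcontinuum_seg hD (iter_mem _ Lq) Lyj jy).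
have lt_m (a b : 'I_(size E).+1) : (b * t - a * t < m)%N.
  apply: leq_ltn_trans tm; rewrite -mulnBl mulnC leq_mul2l.
  by have := ltn_ord b; lia.
exfalso; have [ltij|ltji|/ord_inj eqij] := ltngtP i j.
- apply: (first_return_disjoint mL _ (lt_m i j) LL).
  by rewrite ltn_mul2r t0.
- move: LL; rewrite setIC; apply: (first_return_disjoint mL _ (lt_m j i)).
  by rewrite ltn_mul2r t0.
- by rewrite eqij eqxx in ij.
Qed.

(** A nondegenerate recurrent continuum close to the singleton contains a periodic point of [f],
    which is then close to [x]. *)
Lemma birkhoff_center_degenerate x :
  birkhoff_center F (singleton x) -> birkhoff_center f x.
Proof.
move=> /closure_mdist xF; apply/closure_mdist => e e0.
have [B rB xB] := xF e e0.
have [nB|/degenerateP[y By]] := pselect (nondegenerate (sval B)).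
  have [_ [p Bp pp]] := Rec_nondegenerate rB nB.
  have [_ /(_ p Bp)[_ -> px]] := hyperspace_lt xB.
  by exists p; [exact: Per_Rec|rewrite metric_sym].
exists y; first by apply/(Rec_singleton cf); rewrite -By.
by move: xB; rewrite By singleton_mdist.
Qed.

Lemma first_return_trivIset m L : first_return m L ->
  trivIset `I_m (fun i => sval (iter i F L)).
Proof.
move=> mL i j /= im jm ij; have [ltij|ltji|//] := ltngtP i j.
- exfalso; apply: (first_return_disjoint mL ltij _ ij).
  by rewrite (leq_ltn_trans _ jm)// leq_subr.
- exfalso; move: ij; rewrite setIC; apply: (first_return_disjoint mL ltji).
  by rewrite (leq_ltn_trans _ im)// leq_subr.
Qed.

Lemma cycle_of_treesP m L : (0 < m)%N -> first_return m L ->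
  nondegenerate (sval L) ->
  cycle_of_trees f m (\bigcup_(i in `I_m) (iter i f @` sval L)).
Proof.
move=> m0 mL nL; split => //; exists (sval L); split => //.
- by split => //; exact: svalP.
- rewrite (_ : (fun i => _) = (fun i => sval (iter i F L))).
    exact: first_return_trivIset.
  by apply/funext => i; rewrite sval_iter_induced.
- by have [mLL _] := mL; rewrite -(sval_iter_induced cf) mLL.
Qed.

Lemma cycle_of_trees_blocks k K : cycle_of_trees f k K ->
  exists L, [/\ (0 < k)%N, iter k F L = L,
    trivIset `I_k (fun i => sval (iter i F L)) &
    K = \bigcup_(i in `I_k) sval (iter i F L)].
Proof.
move=> [k0 [L [[sL _] tL kL KE]]]; exists (exist _ L sL); split => //.
- by apply: hyperspace_eq; rewrite sval_iter_induced.
- rewrite (_ : (fun i => _) = (fun i => iter i f @` L))//.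
  by apply/funext => i; rewrite sval_iter_induced.
- by rewrite KE; apply: eq_bigcupr => i _; rewrite sval_iter_induced.
Qed.

(** The component is the decreasing intersection of the blocks of the [K n] which contain [x]. These
    blocks are periodic, and by compactness they converge to it. *)
Lemma solenoidal_birkhoff_center A : solenoidal_components f A ->
  birkhoff_center F A.
Proof.
move=> [_ [K [k [cK KS _]] [x Kx AE]]]; apply/closure_mdist => e e0.
have /choice[B BP] : forall n, exists B, [/\ Per F B, sval B x,
    sval B `<=` K n & forall C, connected C -> C x -> C `<=` K n -> C `<=` sval B].
  move=> n; have [L [k0 kL tL KE]] := cycle_of_trees_blocks (cK n).
  have := Kx n I; rewrite KE => -[i /= ik ix].
  exists (iter i F L); split => //.
  - by exists (k n) => //; rewrite -iterD addnC iterD kL.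
  - by move=> y iy; exists i.
  - move=> C cC Cx CK.
    apply: (connected_in_block _ tL cC CK ik Cx ix) => j.
    exact: hyperspace_closed.
have AB n : sval A `<=` sval (B n).
  have [_ _ _] := BP n; apply.
  - by rewrite AE; exact: component_connected.
  - by rewrite AE; exact: connected_component_refl.
  - by rewrite AE => y /connected_component_sub/(_ n I).
have BS n : sval (B n.+1) `<=` sval (B n).
  have [_ _ _] := BP n; have [_ Bx BK _] := BP n.+1; apply => //.
    by have [] := svalP (B n.+1).
  exact: subset_trans BK (KS n).
have Bmono n m : (n <= m)%N -> sval (B m) `<=` sval (B n).
  move=> /subnK <-; elim: (m - n)%N => [//|l IH].
  by rewrite addSn; apply: subset_trans (BS _) IH.
(* The segment from [x] to [y] stays in every block, so it joins [y] to [x] inside the intersection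
   of the [K n]. *)
have capB y : (forall n, sval (B n) y) -> sval A y.
  move=> By; rewrite AE.
  apply: (connected_component_max (B := seg D x y)).
  - exact: (seg_left hD).
  - move=> z xyz n _; have [_ Bx BK _] := BP n; apply: BK.
    exact: (subcontinuum_seg hD Bx (By n) xyz).
  - exact: (connected_seg hD cT).
  - exact: (seg_right hD).
suff [n Bn] : exists n, forall b, sval (B n) b -> exists2 a, sval A a & mdist b a <= e / 2.
  exists (B n); first by have [/Per_Rec] := BP n.
  apply: (@le_lt_trans _ _ (e / 2)); last by rewrite gtr_pMr// invf_lt1// ltr1n.
  apply: hyperspace_le => //= a Aa; exists a; first exact: AB.
  by rewrite mdistxx divr_ge0// ltW.
apply: contrapT => nB.
have /choice[u uP] : forall n, exists b, sval (B n) b /\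
    forall a, sval A a -> e / 2 < mdist b a.
  move=> n; apply: contrapT => H; apply: nB; exists n => b Bb.
  apply: contrapT => H'; apply: H; exists b; split => // a Aa.
  by rewrite ltNge; apply/negP => ba; apply: H'; exists a.
have [c [_ cu]] : [set: T] `&` cluster (u n @[n --> \oo]) !=set0.
  by apply: cT; exact: filterT.
have Ac : sval A c.
  apply: capB => n; apply: (hyperspace_closed (A := B n)) => V Vc.
  have [] := cu (u @` [set m | (n <= m)%N]) V _ Vc.
    by exists n => // m nm; exists m.
  move=> _ [[m /= nm <-] Vu]; exists (u m); split => //.
  by apply: (Bmono _ _ nm); have [] := uP m.
have e20 : 0 < e / 2 by rewrite divr_gt0.
have [] := cu (range u) [set y | mdist c y < e / 2].
- by exists 0%N => // m _; exists m.
- by apply/nbhs_mdist; exists (e / 2).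
move=> _ [[m _ <-] /= cm]; have [_ /(_ c Ac)] := uP m.
by rewrite metric_sym; lra.
Qed.

Lemma birkhoff_center_nondegenerate A : birkhoff_center F A ->
  nondegenerate (sval A) -> Per F A \/ solenoidal_components f A.
Proof.
move=> /closure_mdist bA nA; have [q [Aq [e0 e00 e0P]]] := nondegenerate_stable_point hD nA.
have approx (e : R) : 0 < e -> exists B, [/\ Per F B, mdist A B < e,
    sval B q & nondegenerate (sval B)].
  move=> e_gt0; have e1 : 0 < Num.min e e0 by rewrite lt_min e_gt0.
  have [B rB] := bA _ e1; rewrite lt_min => /andP[ABe /e0P[Bq nB]].
  by exists B; split => //; have [] := Rec_nondegenerate rB nB.
have [M M0 MP] := Rec_iter_period.
(* As [i] stays the same while the continua tend to [A], the exponent [M * i] serves for all of them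
   and for their limit. *)
have [[i i0 iP]|noi] := pselect (exists2 i, (0 < i)%N & forall e : R, 0 < e ->
    exists B, [/\ Per F B, mdist A B < e & meets B (iter i F B)]).
  left; exists (M * i)%N; first by rewrite muln_gt0 M0.
  apply: fixed_by_approximation.
    by apply: continuous_iter; exact: induced_map_continuous.
  move=> e e_gt0; have [B [pB AB BiB]] := iP e e_gt0.
  by exists B => //; apply: MP => //; exact: Per_Rec.
right; split => //.
have far n : exists2 e : R, 0 < e & forall B, Per F B -> mdist A B < e ->
    forall i, (0 < i <= n)%N -> ~ meets B (iter i F B).
  elim: n => [|n [e e_gt0 eP]].
    by exists 1 => // B _ _ i; rewrite leqn0 => /andP[i0 /eqP ii]; rewrite ii in i0.
  have [e' e'0 e'P] : exists2 e' : R, 0 < e' &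
      forall B, Per F B -> mdist A B < e' -> ~ meets B (iter n.+1 F B).
    apply: contrapT => H; apply: noi; exists n.+1 => // e' e'0.
    apply: contrapT => H'; apply: H; exists e' => // B pB AB BB.
    by apply: H'; exists B.
  exists (Num.min e e'); first by rewrite lt_min e_gt0.
  move=> B pB; rewrite lt_min => /andP[ABe ABe'] i /andP[i0].
  rewrite leq_eqVlt => /orP[/eqP ->|]; first exact: e'P.
  by rewrite ltnS => iN; apply: (eP B) => //; rewrite i0.
pose good (s : nat * (hyperspace T * hyperspace T * nat)) :=
  let: (n, (B, L, m)) := s in
  [/\ Per F B, mdist A B < n.+1%:R^-1, sval B q /\ sval B `<=` sval L,
      (n < m)%N /\ first_return m L & nondegenerate (sval L)].
(* The threshold [N] is left free: it will be the period of the preceding continuum times the number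
   of ends, as [first_return_sub] requires. *)
have next n N : exists B L m, good (n, (B, L, m)) /\ (N < m)%N.
  have [e e_gt0 eP] := far (maxn n N).
  have e1 : 0 < Num.min e n.+1%:R^-1 by rewrite lt_min e_gt0 invr_gt0 ltr0Sn.
  have [B [pB + Bq nB]] := approx _ e1; rewrite lt_min => /andP[ABe ABn].
  have [k k0 kB] := pB.
  have exm : exists m, (0 < m)%N && `[< meets B (iter m F B) >].
    by exists k; rewrite k0; apply/asboolP; rewrite kB setIid; exists q.
  case: (ex_minnP exm) => m /andP[m0 /asboolP BmB] mmin.
  have [a /andP[a0 am] BaB|L BL mL] := first_return_hull k0 kB m0 BmB _.
    by have := mmin a; rewrite a0 leqNgt am => /(_ (asboolT BaB)).
  have maxm : (maxn n N < m)%N.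
    rewrite ltnNge; apply/negP => mle; apply: (eP B pB ABe m _ BmB).
    by rewrite m0.
  move: maxm; rewrite gtn_max => /andP[nm Nm].
  exists B, L, m; split => //; split => //.
  move=> x Lx; apply: (nB x); rewrite Lx in BL; apply/seteqP; split => // y ->.
  by have [[z Bz] _ _] := svalP B; rewrite -(BL z Bz).
have [B0 [L0 [m0 [good0 _]]]] := next 0%N 0%N.
(* Conditional on [good s], so that every state has a successor, as dependent choice requires. *)
pose step (s s' : nat * (hyperspace T * hyperspace T * nat)) :=
  good s -> [/\ s'.1 = s.1.+1, good s' & sval s'.2.1.2 `<=` sval s.2.1.1].
have stepP s : exists s', step s s'.
  case: s => n [[B L] m].
  have [gs|ngs] := pselect (good (n, (B, L, m))); last by exists (n, (B, L, m)).
  have [[t t0 tB] _ [Bq BL] [nm mL] nL] := gs.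
  have [B' [L' [m' [gs' tm]]]] := next n.+1 (t * size E)%N.
  exists (n.+1, (B', L', m')) => _; split => //=.
  have [_ _ [B'q B'L'] [_ mL'] _] := gs'.
  by apply: (first_return_sub t0 tB mL' Bq _ tm); exact: B'L'.
have [s [s0 sS]] := dependent_choice (fun s => cid (stepP s)) (0%N, (B0, L0, m0)).
have gs n : good (s n) /\ (s n).1 = n.
  elim: n => [|n [gn sn]]; first by rewrite s0.
  by have [-> ? _] := sS n gn; rewrite sn.
pose B n := (s n).2.1.1; pose L n := (s n).2.1.2; pose m n := (s n).2.2.
have sP n : [/\ Per F (B n), mdist A (B n) < n.+1%:R^-1,
    sval (B n) q /\ sval (B n) `<=` sval (L n),
    (n < m n)%N /\ first_return (m n) (L n) & nondegenerate (sval (L n))].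
  by have [] := gs n; rewrite /B /L /m; case: (s n) => n' [[B' L'] m'] /= ? <-.
have LB n : sval (L n.+1) `<=` sval (B n) by have [gn _] := gs n; have [] := sS n gn.
have LS n : sval (L n.+1) `<=` sval (L n).
  by have [_ _ [_ BL] _ _] := sP n; exact: subset_trans (LB n) BL.
have Lmono n l : (n <= l)%N -> sval (L l) `<=` sval (L n).
  move=> /subnK <-; elim: (l - n)%N => [//|j IH].
  by rewrite addSn; apply: subset_trans (LS _) IH.
have mF n : iter (m n) F (L n) = L n by have [_ _ _ [_ []]] := sP n.
pose K n := \bigcup_(i in `I_(m n)) (iter i f @` sval (L n)).
have small (e : R) : 0 < e -> exists N : nat, forall n, (N <= n)%N -> n.+1%:R^-1 < e.
  by move=> e_gt0; have [N _ NP] := near_infty_natSinv_lt (PosNum e_gt0); exists N.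
have AL n : sval A `<=` sval (L n).
  apply: hyperspace_sub; first exact: hyperspace_closed.
  move=> e e_gt0; have [N NP] := small e e_gt0.
  have [_ AB [_ BL] _ _] := sP (maxn n N); exists (B (maxn n N)).
    by apply: lt_trans AB _; apply: NP; exact: leq_maxr.
  by apply: subset_trans BL _; apply: Lmono; exact: leq_maxl.
(* Since [L n.+1] lies in [B n], such a [y] lies in every [B n], and these converge to [A]. *)
have LA y : (forall n, sval (L n) y) -> sval A y.
  move=> Ly; apply: (hyperspace_closed (A := A)); apply/closure_mdist => e e_gt0.
  have [N NP] := small e e_gt0; have [_ /hyperspace_lt[_ BA] _ _ _] := sP N.
  have [a Aa ya] := BA y (LB N y (Ly N.+1)); exists a => //.
  exact: lt_trans ya (NP N (leqnn N)).
have KL n : K n = \bigcup_(i in `I_(m n)) sval (iter i F (L n)).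
  by apply: eq_bigcupr => i _; rewrite sval_iter_induced.
have m_gt0 n : (0 < m n)%N by have [_ _ _ [/(leq_ltn_trans (leq0n _))]] := sP n.
have LK n : sval (L n) `<=` K n by move=> y Ly; exists 0%N; [exact: m_gt0|exists y].
exists K.
  exists m; split.
  - move=> n; have [_ _ _ [_ mL] nL] := sP n.
    exact: cycle_of_treesP.
  (* The indices of the blocks of [K n.+1] are reduced modulo the period [m n] of [L n]. *)
  - move=> n; rewrite !KL => y [i _ iy]; exists (i %% m n)%N; first by rewrite /= ltn_mod.
    have := iter_sub (n := i) (LS n) iy; rewrite {1}(divn_eq i (m n)) addnC iterD.
    by rewrite (iter_mul_fixed _ (mF n)).
  - move=> V [N _ NV]; exists N => // n /= Nn; apply: NV => /=.
    have [_ _ _ [nm _] _] := sP n.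
    by rewrite (leq_trans Nn)// ltnW.
have Kq : (\bigcap_n K n) q by move=> n _; exact/LK/AL.
exists q => //; apply/seteqP; split.
  apply: connected_component_max => //.
    by move=> y Ay n _; exact/LK/AL.
  by have [] := svalP A.
(* A connected subset of [K n] through [q] cannot leave the block [L n]. *)
move=> y [C [Cq CK cC] Cy]; apply: LA => n.
have [_ _ _ [_ mL] _] := sP n.
apply: (connected_in_block _ (first_return_trivIset mL) cC _ (m_gt0 n) Cq _ Cy).
- by move=> j; exact: hyperspace_closed.
- by rewrite -KL => z /CK/(_ n I).
- exact: AL.
Qed.

Theorem birkhoff_center_hyperspace :
  birkhoff_center F =
    [set singleton x | x in birkhoff_center f] `|` Per F `|` solenoidal_components f.
Proof.
apply/seteqP; split=> [A bA|A [[[x bx <-]|pA]|sA]].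
- have [nA|/degenerateP[x Ax]] := pselect (nondegenerate (sval A)).
    by have [pA|sA] := birkhoff_center_nondegenerate bA nA; [left; right|right].
  left; left; exists x => //; rewrite Ax in bA *.
  exact: birkhoff_center_degenerate.
- exact: birkhoff_center_singleton.
- exact/subset_closure/Per_Rec.
- exact: solenoidal_birkhoff_center.
Qed.

End Main.

Theorem theorem5p2 (R : realType) (T : metricType R) (f : T -> T)
    (cf : continuous f) (hT : topological_tree T) :
  birkhoff_center (induced_map cf) =
    [set singleton x | x in birkhoff_center f]
    `|` Per (induced_map cf)
    `|` solenoidal_components f.
Proof.
have [[cT _ _] _] := hT; have [D [E hD]] := topological_tree_metric hT.
exact: birkhoff_center_hyperspace hD cT f cf.
Qed.
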